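(* Let $k$ be a field of characteristic $0$, let $P$ be a locally finite poset viewed as a category, let $kP$ be its incidence algebra, and let $S\subseteq kP$ be the subalgebra generated by the identity morphisms in $P$. Let $\Phi: C^\bullet(P;k)\to C^\bullet(kP,S;kP)$ be defined by $$\Phi f=\sum_{i\in P} f(i)E^{ii}\quad\text{for } f\in C^0(P;k),$$ $$(\Phi f)(E^{i_0i_1},\ldots,E^{i_{n-1}i_n})=f(i_0,\ldots,i_n)E^{i_0i_n}\quad\text{for } f\in C^n(P;k),\ n>0.$$ Then $$\Phi:(C^\bullet(P;k)[1],[-,-],d)\to(C^\bullet(kP,S;kP)[1],[-,-],d)$$ is an isomorphism of differential graded Lie algebras.
   Context: A poset $P$ is locally finite if $\{x\in P\mid x_1\le x\le x_2\}$ is finite for all $x_1,x_2\in P$. View $P$ as a category whose objects are the elements of $P$, with a unique morphism $E^{ij}$ from $i$ to $j$ whenever $i\le j$. The incidence algebra $kP$ is the category algebra of $P$ over $k$: its elements are formal sums $\sum_{i\le j} r_{ij}E^{ij}$ with $r_{ij}\in k$, and the product is defined on generators by $E^{ij}E^{jl}=E^{il}$ and $E^{ij}E^{i'l}=0$ for $j\neq i'$. $S$ is the subalgebra of $kP$ generated by the identity morphisms $E^{ii}$, $i\in P$. Simplicial cochains: $C^\bullet(P;k)$ is the simplicial cochain complex of the nerve of $P$; $C^n(P;k)$ is the space of $k$-valued functions on the $n$-simplices $(v_0,\ldots,v_n)$, $v_0\le\cdots\le v_n$, of the nerve. For $f\in C^p(P;k)$, $g\in C^q(P;k)$, $1\le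 j\le p$, put $$(f\circ_jg)(v_0,\ldots,v_{p+q-1})=f(v_0,\ldots,v_{j-1},v_{j+q-1},\ldots,v_{p+q-1})\,g(v_{j-1},\ldots,v_{j+q-1}).$$ The multiplication is the constant 2-cochain $m=m_{\mathrm S}=1$. Relative Hochschild cochains: for an associative unital $k$-algebra $A$ and a subalgebra $S$, $C^n(A,S;A)$, $n>0$, is the space of $k$-multilinear $f:A^n\to A$ with $f(ba_1,\ldots,a_n)=bf(a_1,\ldots,a_n)$, $f(\ldots,a_ib,a_{i+1},\ldots)=f(\ldots,a_i,ba_{i+1},\ldots)$ for $1\le i<n$, and $f(a_1,\ldots,a_nb)=f(a_1,\ldots,a_n)b$ for all $a_1,\ldots,a_n\in A$, $b\in S$; and $C^0(A,S;A)=\{a\in A\mid ab=ba \text{ for all } b\in S\}$. For $f$ of arity $p$ and $g$ of arity $q$, $1\le j\le p$, put $(f\circ_jg)(a_1,\ldots,a_{p+q-1})=f(a_1,\ldots,a_{j-1},g(a_j,\ldots,a_{j+q-1}),a_{j+q},\ldots,a_{p+q-1})$. The multiplication is $m=m_{\mathrm H}$, $m_{\mathrm H}(a_1,a_2)=a_1a_2$. In degree $n>0$, $\Phi f$ is specified by its values on composable tuples of morphisms ($i_0\le i_1\le\cdots\le i_n$) as displayed. In both cases, $C^\bullet[1]$ denotes the shifted graded space, in which an element $f\in C^p$ has degree $|f|=p-1$. The circle product is $f\circ g=\sum_{j=1}^p(-1)^{(j-1)(q-1)}f\circ_jg$ for $f\in C^p$, $g\in C^q$ (zero if $p=0$). The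 bracket is $[f,g]=f\circ g-(-1)^{|f||g|}g\circ f$ and the differential on $C^\bullet[1]$ is $df=m\circ f-(-1)^{|f|}f\circ m=[m,f]$.
   Formalization: The subalgebra S generated by the identity morphisms is taken to be closed under formal sums, so it consists of all sums of r_i E^{ii}; with only finite combinations, Φ fails to be surjective for some infinite P. For finite P nothing changes. *)

(* Defs.v *)
From HB Require Import structures.
From mathcomp Require Import all_boot all_order all_algebra.
From mathcomp Require Import zify.
From mathcomp Require Import mathcomp_extra boolp classical_sets functions.
From mathcomp Require Import cardinality fsbigop.

Set Implicit Arguments.
Unset Strict Implicit.
Unset Printing Implicit Defensive.

Import Order.TTheory GRing.Theory.
Local Open Scope ring_scope.

(** * Differential graded Lie algebras *)

(* A bracket of degree 0 and a map of degree 1 on a graded space.  The degree  *)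
(* of a result is a variable tied by an equation, so that the axioms below,    *)
(* whose two sides live in provably equal degrees, need no transport.          *)
Record dgData (k : fieldType) := DgData {
  dg_car :> int -> lmodType k;
  dg_br : forall a b c : int, a + b = c -> dg_car a -> dg_car b -> dg_car c;
  dg_d : forall a b : int, a + 1 = b -> dg_car a -> dg_car b
}.

Definition ksign (k : fieldType) (n : int) : k := (-1) ^ n.
Arguments ksign : clear implicits.

Record is_dgLie (k : fieldType) (L : dgData k) : Prop := IsDgLie {
  dg_br_linearl : forall a b c (e : a + b = c) (y : L b),
    linear (fun x : L a => dg_br e x y);
  dg_br_linearr : forall a b c (e : a + b = c) (x : L a),
    linear (fun y : L b => dg_br e x y);
  dg_d_linear : forall a b (e : a + 1 = b), linear (@dg_d k L a b e);
  dg_br_anti : forall a b c (e : a + b = c) (e' : b + a = c) (x : L a) (y : L b),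
    dg_br e x y = - (ksign k (a * b) *: dg_br e' y x);
  dg_jacobi : forall a b c ab bc ac t
      (eab : a + b = ab) (ebc : b + c = bc) (eac : a + c = ac)
      (e1 : a + bc = t) (e2 : ab + c = t) (e3 : b + ac = t)
      (x : L a) (y : L b) (z : L c),
    dg_br e1 x (dg_br ebc y z) =
      dg_br e2 (dg_br eab x y) z + ksign k (a * b) *: dg_br e3 y (dg_br eac x z);
  dg_d_square : forall a b c (e : a + 1 = b) (e' : b + 1 = c) (x : L a),
    dg_d e' (dg_d e x) = 0;
  dg_d_leibniz : forall a b c a' b' c' (e : a + b = c)
      (ea : a + 1 = a') (eb : b + 1 = b') (ec : c + 1 = c')
      (e1 : a' + b = c') (e2 : a + b' = c') (x : L a) (y : L b),
    dg_d ec (dg_br e x y) =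
      dg_br e1 (dg_d ea x) y + ksign k a *: dg_br e2 x (dg_d eb y)
}.

Record is_dgLie_iso (k : fieldType) (L M : dgData k)
    (phi : forall a : int, L a -> M a) : Prop := IsDgLieIso {
  dg_iso_source : is_dgLie L;
  dg_iso_target : is_dgLie M;
  dg_iso_linear : forall a, linear (phi a);
  dg_iso_bij : forall a, bijective (phi a);
  dg_iso_br : forall a b c (e : a + b = c) (x : L a) (y : L b),
    phi c (dg_br e x y) = dg_br e (phi a x) (phi b y);
  dg_iso_d : forall a b (e : a + 1 = b) (x : L a),
    phi b (dg_d e x) = dg_d e (phi a x)
}.

(** * Cochains with partial compositions and a multiplication *)

(* [op_comp e j f g] is f o_{j+1} g: the index j : 'I_`|p| starts at 0.  The   *)
(* spaces are indexed by all integers; those of negative arity will be 0.      *)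
Record opData (k : fieldType) := OpData {
  op_car :> int -> lmodType k;
  op_comp : forall p q r : int, p + q = r + 1 ->
    'I_`|p| -> op_car p -> op_car q -> op_car r;
  op_mult : op_car 2
}.

Section Gerstenhaber.
Variables (k : fieldType) (C : opData k).

Definition circ (p q r : int) (e : p + q = r + 1) (f : C p) (g : C q) : C r :=
  \sum_(j < `|p|) ksign k (j%:Z * (q - 1)) *: op_comp e j f g.

Definition shift (a : int) : lmodType k := C (a + 1).

Fact shift_br_eq (a b c : int) : a + b = c -> (a + 1) + (b + 1) = (c + 1) + 1.
Proof. lia. Qed.

Fact shift_brC_eq (a b c : int) : a + b = c -> (b + 1) + (a + 1) = (c + 1) + 1.
Proof. lia. Qed.

Fact shift_dl_eq (a b : int) : a + 1 = b -> 2 + (a + 1) = (b + 1) + 1.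
Proof. lia. Qed.

Fact shift_dr_eq (a b : int) : a + 1 = b -> (a + 1) + 2 = (b + 1) + 1.
Proof. lia. Qed.

Definition gbracket (a b c : int) (e : a + b = c) (f : shift a) (g : shift b) :
    shift c :=
  circ (shift_br_eq e) f g - ksign k (a * b) *: circ (shift_brC_eq e) g f.

Definition gdiff (a b : int) (e : a + 1 = b) (f : shift a) : shift b :=
  circ (shift_dl_eq e) (op_mult C) f -
  ksign k a *: circ (shift_dr_eq e) f (op_mult C).

Definition dg_of_op : dgData k := @DgData k shift gbracket gdiff.

End Gerstenhaber.

(** * Simplicial cochains of a poset *)

Section Simplicial.
Variables (k : fieldType) (d : Order.disp_t) (P : porderType d).

Definition simplex (n : int) : Type :=
  {s : seq P | [&& s != [::], (size s)%:Z == n + 1 & sorted <=%O s]}.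

Definition scochain (n : int) : lmodType k := simplex n -> k^o.

(* The value of f at (v_0, ..., v_n), and 0 on what is not an n-simplex. *)
Definition sc_app (n : int) (f : scochain n) (v : seq P) : k :=
  oapp (f : simplex n -> k) 0 (insub v).

Definition scomp (p q r : int) (_ : p + q = r + 1) (j : 'I_`|p|)
    (f : scochain p) (g : scochain q) : scochain r :=
  fun v => sc_app f (take j.+1 (\val v) ++ drop (j + `|q|) (\val v)) *
           sc_app g (take `|q|.+1 (drop j (\val v))).

Definition smult : scochain 2 := fun=> 1.

Definition simplicial : opData k := @OpData k scochain scomp smult.

End Simplicial.

(** * Relative Hochschild cochains *)

(* Associative unital k-algebras.  The [algType] of MathComp excludes the zero *)
(* algebra, which is the incidence algebra of the empty poset.                 *)
Record kalgebra (k : fieldType) := KAlgebra {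
  ka_car :> lmodType k;
  ka_one : ka_car;
  ka_mul : ka_car -> ka_car -> ka_car;
  ka_mulA : associative ka_mul;
  ka_mul1l : left_id ka_one ka_mul;
  ka_mul1r : right_id ka_one ka_mul;
  ka_linearl : forall y, linear (ka_mul^~ y);
  ka_linearr : forall x, linear (ka_mul x)
}.

Declare Scope kalg_scope.
Delimit Scope kalg_scope with KA.
Notation "x ** y" := (ka_mul x y)
  (at level 40, left associativity) : kalg_scope.
Local Open Scope kalg_scope.

Lemma ka_mul0l (k : fieldType) (A : kalgebra k) (y : A) : 0 ** y = 0.
Proof.
by have := ka_linearl y (-1) 0 0; rewrite scaler0 addr0 scaleN1r addNr.
Qed.

Lemma ka_mul0r (k : fieldType) (A : kalgebra k) (x : A) : x ** 0 = 0.
Proof.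
by have := ka_linearr x (-1) 0 0; rewrite scaler0 addr0 scaleN1r addNr.
Qed.

Section Hochschild.
Variables (k : fieldType) (A : kalgebra k) (S : set A).

Definition args (n : int) : Type := {s : seq A | (size s)%:Z == n}.

(* The value of f at (a_1, ..., a_n), and 0 on tuples of another length. *)
Definition happ (n : int) (f : args n -> A) (s : seq A) : A :=
  oapp f 0 (insub s).

(* For f : A^n -> A extended by 0 as in [happ], each equation is trivial on    *)
(* tuples whose length is not n; [rel_0] is the condition for n = 0, the       *)
(* others are those for n > 0.                                                 *)
Record relative (f : seq A -> A) : Prop := Relative {
  rel_lin : forall s1 s2 (c : k) x y,
    f (s1 ++ (c *: x + y) :: s2) = c *: f (s1 ++ x :: s2) + f (s1 ++ y :: s2);
  rel_0 : forall b, S b -> f [::] ** b = b ** f [::];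
  rel_l : forall a b s, S b -> f (b ** a :: s) = b ** f (a :: s);
  rel_m : forall a b a' s1 s2, S b ->
    f (s1 ++ a ** b :: a' :: s2) = f (s1 ++ a :: b ** a' :: s2);
  rel_r : forall a b s, S b -> f (rcons s (a ** b)) = f (rcons s a) ** b
}.

Definition relcochain_pred (n : int) : {pred args n -> A} :=
  fun f => `[< relative (happ f) >].
Arguments relcochain_pred : clear implicits.

Record relcochain (n : int) := RelCochain {
  rc_fun : args n -> A;
  rc_funP : rc_fun \in relcochain_pred n
}.

HB.instance Definition _ (n : int) := [isSub for @rc_fun n].
HB.instance Definition _ (n : int) := [Choice of relcochain n by <:].

Lemma happD n (c : k) (f g : args n -> A) s :
  happ (c *: f + g) s = c *: happ f s + happ g s.
Proof.
by rewrite /happ; case: insubP => //= _; rewrite scaler0 addr0.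
Qed.

Lemma happ0 n s : happ (0 : args n -> A) s = 0.
Proof. by rewrite /happ; case: insubP. Qed.

Lemma happ_out n (f : args n -> A) s : (size s)%:Z != n -> happ f s = 0.
Proof. by move=> h; rewrite /happ insubN. Qed.

Fact relcochain_submod n : submod_closed (relcochain_pred n).
Proof.
split.
  by apply/asboolP; split=> *; rewrite !happ0 ?ka_mul0l ?ka_mul0r ?scaler0 ?addr0.
move=> c f g /asboolP[fl f0 fa fm fr] /asboolP[gl g0 ga gm gr].
apply/asboolP; split=> *; rewrite !happD.
- rewrite fl gl !scalerDr !scalerA mulrC -!addrA; congr (_ + _).
  by rewrite addrCA.
- by rewrite ka_linearl ka_linearr f0 // g0.
- by rewrite fa // ga // ka_linearr.
- by rewrite fm // gm.
- by rewrite fr // gr // ka_linearl.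
Qed.

HB.instance Definition _ (n : int) :=
  GRing.isSubmodClosed.Build k (args n -> A) (relcochain_pred n)
    (relcochain_submod n).
HB.instance Definition _ (n : int) :=
  [SubChoice_isSubLmodule of relcochain n by <:].

(* [rc_app f [:: a_1; ..; a_n]] is f(a_1, ..., a_n). *)
Definition rc_app (n : int) (f : relcochain n) : seq A -> A := happ (rc_fun f).

Lemma rc_relative n (f : relcochain n) : relative (rc_app f).
Proof. exact/asboolP/(rc_funP f). Qed.

Definition hcomp_fun (p q r : int) (j : 'I_`|p|)
    (f : relcochain p) (g : relcochain q) : args r -> A :=
  fun s => rc_app f (take j (\val s) ++
                     rc_app g (take `|q| (drop j (\val s))) ::
                     drop (j + `|q|) (\val s)).

Section Comp.
Variables (p q r : int) (e : p + q = r + 1) (j : 'I_`|p|).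
Variables (f : relcochain p) (g : relcochain q).
Let F := rc_app f.
Let G := rc_app g.
Let H := happ (@hcomp_fun p q r j f g).

Let HE u v w : size u = j -> size v = `|q|%N ->
  (size (u ++ v ++ w))%:Z = r -> H (u ++ v ++ w) = F (u ++ G v :: w).
Proof.
move=> su sv sr; rewrite /H /happ.
case: insubP => [t _ et|]; last by rewrite sr eqxx.
rewrite /= /hcomp_fun et -su -sv take_size_cat // drop_size_cat //.
by rewrite take_size_cat // addnC -drop_drop !drop_size_cat.
Qed.

Let Hout s : (size s)%:Z != r -> H s = 0.
Proof. exact: happ_out. Qed.

Let H0 : (p < 0) || (q < 0) -> forall s, H s = 0.
Proof.
have FL := rel_lin (rc_relative f).
have F00 s1 s2 : F (s1 ++ 0 :: s2) = 0.
  by have := FL s1 s2 (-1) 0 0; rewrite scaler0 addr0 scaleN1r addNr.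
move=> pq s; rewrite /H /happ; case: insubP => //= t _ _.
rewrite /hcomp_fun; case/orP: pq => h; first by apply: happ_out; lia.
by rewrite [rc_app g _]happ_out ?F00 //; lia.
Qed.

Let split3 (s1 s2 : seq A) : (j + `|q| <= (size s1 + size s2).+1)%N ->
  [\/ exists u v w, [/\ s2 = u ++ v ++ w, (size s1 + (size u).+1 = j)%N
                      & size v = `|q|%N],
      exists u v1 v2 w, [/\ s1 = u ++ v1, s2 = v2 ++ w, size u = j
                      & (size v1 + (size v2).+1 = `|q|)%N]
    | exists u v w, [/\ s1 = u ++ v ++ w, size u = j & size v = `|q|%N]].
Proof.
move=> h; case: (ltnP (size s1) j) => h1.
  constructor 1; exists (take (j - (size s1).+1) s2).
  exists (take `|q| (drop (j - (size s1).+1) s2)).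
  exists (drop `|q| (drop (j - (size s1).+1) s2)).
  by rewrite !cat_take_drop !size_takel ?size_drop; [split=> //; lia|lia|lia].
case: (ltnP (size s1) (j + `|q|)) => h2.
  constructor 2; exists (take j s1), (drop j s1).
  exists (take (j + `|q| - (size s1).+1) s2).
  exists (drop (j + `|q| - (size s1).+1) s2).
  by rewrite !cat_take_drop !size_takel ?size_drop; [split=> //; lia|lia|lia].
constructor 3; exists (take j s1), (take `|q| (drop j s1)).
exists (drop `|q| (drop j s1)).
by rewrite !cat_take_drop !size_takel ?size_drop; [split=> //; lia|lia|lia].
Qed.

Fact hcomp_relative : @hcomp_fun p q r j f g \in relcochain_pred r.
Proof.
apply/asboolP; rewrite -/H.
have [FL F0 Fl Fm Fr] := rc_relative f.
have [GL G0 Gl Gm Gr] := rc_relative g.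
rewrite -!/F -!/G in FL F0 Fl Fm Fr GL G0 Gl Gm Gr.
have [neg|/norP[p0 q0]] := boolP ((p < 0) || (q < 0)).
  by split=> *; rewrite !H0 // ?ka_mul0l ?ka_mul0r ?scaler0 ?addr0.
have jp := ltn_ord j.
have fit (s1 s2 : seq A) x : (size (s1 ++ x :: s2))%:Z = r ->
    (j + `|q| <= (size s1 + size s2).+1)%N.
  by rewrite size_cat /=; lia.
split.
- move=> s1 s2 c x y.
  have [sr|sr] := eqVneq (size (s1 ++ x :: s2))%:Z r; last first.
    rewrite !Hout ?scaler0 ?addr0 //; move: sr; rewrite !size_cat //=.
  case: (split3 (fit _ _ _ sr)); rewrite size_cat /= in sr.
  + move=> [u [v [w [es s1j vq]]]]; subst s2.
    have X z : H (s1 ++ z :: u ++ v ++ w) = F (s1 ++ z :: u ++ G v :: w).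
      have -> : s1 ++ z :: u ++ v ++ w = (s1 ++ z :: u) ++ v ++ w by rewrite -catA.
      rewrite HE -?catA //; rewrite ?size_cat /= ?size_cat in sr *; lia.
    by rewrite !X FL.
  + move=> [u [v1 [v2 [w [es1 es2 uj vq]]]]]; subst s1 s2.
    have X z : H ((u ++ v1) ++ z :: v2 ++ w) = F (u ++ G (v1 ++ z :: v2) :: w).
      have -> : (u ++ v1) ++ z :: v2 ++ w = u ++ (v1 ++ z :: v2) ++ w.
        by rewrite -!catA.
      rewrite HE //; rewrite ?size_cat /= ?size_cat in sr *; lia.
    by rewrite !X GL FL.
  + move=> [u [v [w [es uj vq]]]]; subst s1.
    have X z : H ((u ++ v ++ w) ++ z :: s2) = F ((u ++ G v :: w) ++ z :: s2).
      by rewrite -!catA HE //; rewrite ?size_cat /= in sr *; lia.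
    by rewrite !X FL.
- move=> b Sb.
  have [r0|r0] := eqVneq r 0; last by rewrite Hout ?ka_mul0l ?ka_mul0r //= eq_sym.
  have -> : H [::] = F [:: G [::]] by apply: (HE (u := [::]) (v := [::])) => /=; lia.
  by have /= := Fr (G [::]) b [::] Sb => <-; rewrite G0 // Fl.
- move=> a b s Sb.
  have [sr|sr] := eqVneq (size ([::] ++ a :: s))%:Z r; last first.
    by rewrite !Hout ?ka_mul0r //; move: sr; rewrite !size_cat.
  case: (split3 (fit _ _ _ sr)); rewrite /= in sr.
  + move=> [u [v [w [es s1j vq]]]]; subst s.
    rewrite -2!cat_cons !HE //= ?size_cat //; rewrite ?size_cat /= in sr *; try lia.
    by rewrite Fl.
  + move=> [u [v1 [v2 [w [+ es uj vq]]]]]; subst s.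
    case: u uj => // uj; case: v1 vq => // vq _.
    have X z : H (z :: v2 ++ w) = F (G (z :: v2) :: w).
      by apply: (HE (u := [::]) (v := z :: v2)) => //=; rewrite size_cat in sr *; lia.
    by rewrite !X Gl // Fl.
  + move=> [u [v [w [+ uj vq]]]]; case: u uj => // uj; case: v vq => // vq _.
    have X z : H (z :: s) = F (G [::] :: z :: s).
      by apply: (HE (u := [::]) (v := [::])) => //=.
    by rewrite !X -(Fm (G [::]) b a [::]) //= G0 // Fl.
- move=> a b y s1 s2 Sb.
  have [sr|sr] := eqVneq (size (s1 ++ a :: y :: s2))%:Z r; last first.
    by rewrite !Hout //; move: sr; rewrite !size_cat.
  case: (split3 (fit _ _ _ sr)); rewrite size_cat /= in sr.
  + move=> [u [v [w [es s1j vq]]]].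
    case: u es s1j => [|y' u] /=.
      case: v vq => [|y' v] /= vq.
        move=> ew s1j; subst w.
        have X x z : H (s1 ++ x :: z :: s2) = F (s1 ++ x :: G [::] :: z :: s2).
          rewrite -cat_rcons -[z :: s2]cat0s HE ?size_rcons ?size_cat //=.
          - by rewrite cat_rcons.
          - lia.
          - by rewrite size_rcons; lia.
        rewrite !X Fm // -G0 //.
        by have := Fm (G [::]) b y (rcons s1 a) s2 Sb; rewrite !cat_rcons.
      move=> [ey es] s1j; subst y' s2.
      have X x z : H (s1 ++ x :: z :: v ++ w) = F (s1 ++ x :: G (z :: v) :: w).
        rewrite -cat_rcons -[z :: v ++ w]cat_cons HE ?size_rcons ?size_cat //=.
        - by rewrite cat_rcons.
        - lia.
        - by rewrite size_rcons ?size_cat; rewrite size_cat in sr; lia.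
      by rewrite !X Gl // Fm.
    move=> [ey es] s1j; subst y' s2.
    have X x z : H (s1 ++ x :: z :: u ++ v ++ w) = F (s1 ++ x :: z :: u ++ G v :: w).
      have -> : s1 ++ x :: z :: u ++ v ++ w = (s1 ++ x :: z :: u) ++ v ++ w.
        by rewrite -catA.
      rewrite HE -?catA //; rewrite ?size_cat /= ?size_cat in sr *; lia.
    by rewrite !X Fm.
  + move=> [u [v1 [v2 [w [es1 es uj vq]]]]]; subst s1.
    case: v2 es vq => [|y' v2] /=.
      move=> ew vq; subst w.
      have X x z : H ((u ++ v1) ++ x :: z :: s2) = F (u ++ G (rcons v1 x) :: z :: s2).
        rewrite -catA -cat_rcons HE ?size_rcons //; last first.
          by rewrite ?size_cat ?size_rcons /= in sr *; lia.
        by lia.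
      by rewrite !X Gr // Fm.
    move=> [ey es] vq; subst y' s2.
    have X x z : H ((u ++ v1) ++ x :: z :: v2 ++ w) = F (u ++ G (v1 ++ x :: z :: v2) :: w).
      have -> : (u ++ v1) ++ x :: z :: v2 ++ w = u ++ (v1 ++ x :: z :: v2) ++ w.
        by rewrite -!catA.
      rewrite HE //; rewrite ?size_cat /= ?size_cat in sr *; lia.
    by rewrite !X Gm.
  + move=> [u [v [w [es uj vq]]]]; subst s1.
    have X x z : H ((u ++ v ++ w) ++ x :: z :: s2) = F ((u ++ G v :: w) ++ x :: z :: s2).
      by rewrite -!catA HE //; rewrite ?size_cat /= in sr *; lia.
    by rewrite !X Fm.
- move=> a b s Sb; rewrite -!cats1.
  have [sr|sr] := eqVneq (size (s ++ [:: a]))%:Z r; last first.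
    by rewrite !Hout ?ka_mul0l //; move: sr; rewrite !size_cat.
  case: (split3 (fit _ _ _ sr)); rewrite size_cat /= in sr.
  + move=> [[|? ?] [[|? ?] [[|? ?] [//= _ sj q00]]]].
    have X x : H (s ++ [:: x]) = F (s ++ [:: x; G [::]]).
      rewrite -[s ++ [:: x]]cats0 -[[::] in LHS]cats0.
      rewrite HE; [by rewrite -catA | | |];
        rewrite ?size_cat /= ?size_cat /= in sr *; lia.
    rewrite !X Fm // -G0 //.
    by have := Fr (G [::]) b (rcons s a) Sb; rewrite -!cats1 -!catA.
  + move=> [u [v1 [[|? ?] [[|? ?] [es //= _ uj vq]]]]]; subst s.
    have X x : H ((u ++ v1) ++ [:: x]) = F (rcons u (G (rcons v1 x))).
      rewrite -catA -[v1 ++ [:: x]]cats0 HE -?cats1 ?size_cat //=.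
        by rewrite ?size_cat /= ?size_cat /= in sr *; lia.
    by rewrite !X Gr // Fr.
  + move=> [u [v [w [es uj vq]]]]; subst s.
    have X x : H ((u ++ v ++ w) ++ [:: x]) = F (rcons (u ++ G v :: w) x).
      by rewrite -cats1 -!catA HE //; rewrite ?size_cat /= ?size_cat /= in sr *; lia.
    by rewrite !X Fr.
Qed.

Definition hcomp : relcochain r := RelCochain hcomp_relative.

End Comp.

Definition hmult_fun : args 2 -> A :=
  fun s => nth 0 (\val s) 0 ** nth 0 (\val s) 1.

Fact hmult_relative : hmult_fun \in relcochain_pred 2.
Proof.
apply/asboolP.
have ME a b : happ hmult_fun [:: a; b] = a ** b.
  by rewrite /happ; case: insubP => [t _ et|//]; rewrite /= /hmult_fun et.
have M0 s : size s != 2 -> happ hmult_fun s = 0 by move=> h; apply: happ_out; lia.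
split.
- move=> [|a [|b s1]] s2 c x y.
  + case: s2 => [|b [|b' s2]] /=; rewrite ?ME ?ka_linearl //.
    * by rewrite !M0 // scaler0 addr0.
    * by rewrite !M0 // scaler0 addr0.
  + case: s2 => [|b s2] /=; first by rewrite ?ME ?ka_linearr.
    by rewrite !M0 // scaler0 addr0.
  + by rewrite !M0 ?scaler0 ?addr0 // !size_cat /=; lia.
- by move=> b _; rewrite M0 // ka_mul0l ka_mul0r.
- move=> a b [|a' [|a'' s]] _; rewrite ?ME ?ka_mulA //.
  + by rewrite !M0 // ka_mul0r.
  + by rewrite !M0 // ka_mul0r.
- move=> a b a' [|a1 s1] [|a2 s2] _; rewrite /= ?ME ?ka_mulA //;
    by rewrite !M0 // /= size_cat /=; lia.
- move=> a b [|a' [|a'' s]] _ /=; rewrite ?ME ?ka_mulA //;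
    by rewrite !M0 ?ka_mul0l //= size_rcons.
Qed.

Definition hmult : relcochain 2 := RelCochain hmult_relative.

Definition hochschild : opData k :=
  @OpData k (fun n => relcochain n) hcomp hmult.

End Hochschild.

(** * The incidence algebra of a locally finite poset *)

Definition locally_finite (d : Order.disp_t) (P : porderType d) : Prop :=
  forall x y : P, finite_set [set z | (x <= z <= y)%O]%classic.

Section Incidence.
Variables (k : fieldType) (d : Order.disp_t) (P : porderType d).
Hypothesis lfP : locally_finite P.

(* The formal sum of the r_ij E^ij over all i <= j is the family (r_ij). *)
Definition incidence : lmodType k := {ij : P * P | (ij.1 <= ij.2)%O} -> k^o.

Definition icoef (a : incidence) (i j : P) : k :=
  oapp (a : {ij : P * P | (ij.1 <= ij.2)%O} -> k) 0 (insub (i, j)).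

Definition formal_sum (r : P -> P -> k) : incidence :=
  fun ij => r (\val ij).1 (\val ij).2.

(* The morphism E^ij, meaningful for i <= j. *)
Definition mor (i j : P) : incidence :=
  formal_sum (fun i' j' => ((i', j') == (i, j))%:R).

(* The formal sum of the r_i E^ii over all i. *)
Definition diag_sum (r : P -> k) : incidence :=
  formal_sum (fun i j => if i == j then r i else 0).

Definition imul (a b : incidence) : incidence :=
  formal_sum (fun i l =>
    \sum_(j \in [set j | (i <= j <= l)%O]%classic) icoef a i j * icoef b j l).

Definition ione : incidence := diag_sum (fun _ => 1).

Lemma incidenceP (a b : incidence) :
  (forall i j, (i <= j)%O -> icoef a i j = icoef b i j) -> a = b.
Proof.
move=> h; apply/funext => -[[i j] /= ij].
by have := h i j ij; rewrite /icoef !insubT.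
Qed.

Lemma icoef_out a i j : ~~ (i <= j)%O -> icoef a i j = 0.
Proof. by move=> h; rewrite /icoef insubN. Qed.

Lemma icoef_sum r i j : (i <= j)%O -> icoef (formal_sum r) i j = r i j.
Proof. by move=> ij; rewrite /icoef insubT. Qed.

Lemma icoefD c a b i j : icoef (c *: a + b) i j = c * icoef a i j + icoef b i j.
Proof. by rewrite /icoef; case: insubP => //= _; rewrite mulr0 addr0. Qed.

Lemma icoef_mul a b i l (s : seq P) : (i <= l)%O -> uniq s ->
  (forall j, (i <= j <= l)%O -> j \in s) ->
  icoef (imul a b) i l = \sum_(j <- s) icoef a i j * icoef b j l.
Proof.
move=> il us sil; rewrite icoef_sum // (fsbig_fwiden s) //.
move=> j /= [_ /negP]; rewrite negb_and => /orP[] h.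
  by rewrite icoef_out // mul0r.
by rewrite [X in _ * X]icoef_out // mulr0.
Qed.

Lemma interval_seq i l :
  exists2 s : seq P, uniq s & forall j, (i <= j <= l)%O -> j \in s.
Proof.
have /finite_seqP[s es] := lfP i l; exists (undup s); first exact: undup_uniq.
move=> j ij; rewrite mem_undup.
by have : [set z | (i <= z <= l)%O]%classic j by []; rewrite es.
Qed.

Fact imulA : associative imul.
Proof.
move=> a b c; apply: incidenceP => i l il.
have [s us sil] := interval_seq i l.
rewrite !(icoef_mul _ _ il us) //.
transitivity (\sum_(j <- s) \sum_(m <- s)
    icoef a i j * (icoef b j m * icoef c m l)).
  apply: eq_bigr => j _; rewrite -mulr_sumr.
  have [ij|?] := boolP (i <= j)%O; last by rewrite icoef_out // !mul0r.
  have [jl|jl] := boolP (j <= l)%O.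
    rewrite -(icoef_mul _ _ jl us) // => m /andP[jm ml].
    by apply: sil; rewrite ml (le_trans ij jm).
  congr (_ * _); rewrite icoef_out // big1 // => m _.
  have [jm|?] := boolP (j <= m)%O; last by rewrite icoef_out // mul0r.
  rewrite [X in _ * X]icoef_out ?mulr0 //; apply: contra jl; exact: le_trans.
rewrite exchange_big; apply: eq_bigr => m _ /=.
under eq_bigr do rewrite mulrA.
rewrite -mulr_suml.
have [ml|?] := boolP (m <= l)%O; last by rewrite [X in _ * X]icoef_out // [RHS]mulrC icoef_out ?mul0r ?mulr0.
have [im|im] := boolP (i <= m)%O.
  rewrite -(icoef_mul _ _ im us) // => j /andP[ij jm].
  by apply: sil; rewrite ij (le_trans jm ml).
congr (_ * _); rewrite [RHS]icoef_out // big1 // => j _.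
have [ij|?] := boolP (i <= j)%O; last by rewrite icoef_out // mul0r.
rewrite [X in _ * X]icoef_out ?mulr0 //; apply: contra im; exact: le_trans.
Qed.

Fact imul1l : left_id ione imul.
Proof.
move=> a; apply: incidenceP => i l il.
have [s us sil] := interval_seq i l.
have si : i \in s by apply: sil; rewrite lexx il.
rewrite (icoef_mul _ _ il us) // (bigD1_seq i) //= icoef_sum // eqxx mul1r.
rewrite big1 ?addr0 // => j ji.
have [ij|?] := boolP (i <= j)%O; last by rewrite icoef_out // mul0r.
by rewrite icoef_sum // eq_sym (negbTE ji) mul0r.
Qed.

Fact imul1r : right_id ione imul.
Proof.
move=> a; apply: incidenceP => i l il.
have [s us sil] := interval_seq i l.
have sl : l \in s by apply: sil; rewrite lexx il.
rewrite (icoef_mul _ _ il us) // (bigD1_seq l) //= [X in _ * X + _]icoef_sum //.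
rewrite eqxx mulr1 big1 ?addr0 // => j jl.
have [jl'|?] := boolP (j <= l)%O; last by rewrite [X in _ * X]icoef_out // mulr0.
by rewrite [X in _ * X]icoef_sum // (negbTE jl) mulr0.
Qed.

Fact imul_linearl b : linear (imul^~ b).
Proof.
move=> c x y; apply: incidenceP => i l il.
have [s us sil] := interval_seq i l.
rewrite icoefD !(icoef_mul _ _ il us) // mulr_sumr -big_split /=.
by apply: eq_bigr => j _; rewrite icoefD mulrDl mulrA.
Qed.

Fact imul_linearr a : linear (imul a).
Proof.
move=> c x y; apply: incidenceP => i l il.
have [s us sil] := interval_seq i l.
rewrite icoefD !(icoef_mul _ _ il us) // mulr_sumr -big_split /=.
by apply: eq_bigr => j _; rewrite icoefD mulrDr mulrCA.
Qed.

Definition incidence_alg : kalgebra k :=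
  KAlgebra imulA imul1l imul1r imul_linearl imul_linearr.

Definition is_subalgebra (U : set incidence_alg) : Prop :=
  [/\ U (ka_one _),
      forall (c : k) a b, U a -> U b -> U (c *: a + b)
    & forall a b, U a -> U b -> U (a ** b)].

(* Stability under formal sums: every finite set of coefficients of a is that  *)
(* of an element of U.                                                         *)
Definition formally_closed (U : set incidence_alg) : Prop :=
  forall a : incidence_alg,
    (forall s : seq (P * P), exists2 u, U u &
       {in s, forall ij, icoef u ij.1 ij.2 = icoef a ij.1 ij.2}) ->
    U a.

(* As the elements E^ij generate the algebra of formal sums, the elements E^ii *)
(* generate S in the sense of formal sums: S contains sum_i r_i E^ii for all   *)
(* families r.  For finite P every subset is formally closed.  For infinite P  *)
(* the finite combinations of 1 and the E^ii would not do: for P made of i < l *)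
(* with infinitely many x_n > i and y_n < l, and phi a nonzero linear form on  *)
(* k^N vanishing on the finite sequences, the relative 2-cochain               *)
(*   (a, b) |-> phi (n |-> a_{i x_n}) phi (n |-> b_{y_n l}) E^il               *)
(* would be 0 on all pairs of morphisms.                                       *)
Definition id_subalgebra : set incidence_alg :=
  smallest [set U | is_subalgebra U /\ formally_closed U]%classic
    [set mor i i | i in [set: P]]%classic.

Definition cochain_map : Type :=
  forall n : int, scochain k P n -> relcochain id_subalgebra n.

Definition is_Phi (Phi : cochain_map) : Prop :=
  (forall f : scochain k P 0,
     rc_app (Phi 0 f) [::] = diag_sum (fun i => sc_app f [:: i])) /\
  (forall (n : nat) (f : scochain k P n) (i0 : P) (p : seq P),
     (0 < n)%N -> size p = n -> path <=%O i0 p ->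
     rc_app (Phi n f) (pairmap mor i0 p) = sc_app f (i0 :: p) *: mor i0 (last i0 p)).

End Incidence.

Definition simplicial_dg (k : fieldType) (d : Order.disp_t) (P : porderType d) :
    dgData k :=
  dg_of_op (simplicial k P).

Definition hochschild_dg (k : fieldType) (d : Order.disp_t) (P : porderType d)
    (lfP : locally_finite P) : dgData k :=
  dg_of_op (hochschild (@id_subalgebra k d P lfP)).

Definition shift_map (k : fieldType) (d : Order.disp_t) (P : porderType d)
    (lfP : locally_finite P) (Phi : cochain_map k lfP) (a : int) :
    simplicial_dg k P a -> hochschild_dg k lfP a :=
  Phi (a + 1).

(* Main.v *)
(* A relative cochain [g] is determined by its values on composable morphisms,  *)
(* and these are multiples of the composite.  Since S contains all diagonal     *)
(* elements, the coefficient of g(a_1, .., a_n) at (i, l) does not change when  *)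
(* the arguments are cut down to the finite interval [i, l], and multilinearity *)
(* reduces it to morphisms.  Hence Phi has an inverse, [chain_values], and the  *)
(* compatibility with the partial compositions need only be checked on chains.  *)
(* The simplicial circle product is graded pre-Lie, so its commutator satisfies *)
(* the Jacobi identity; as d = [m, -] with m o m = 0, Jacobi also gives the     *)
(* Leibniz rule and 2 d^2 = 0.  The structure is transported along Phi.         *)
Require Import Defs.
From mathcomp Require Import all_boot all_order all_algebra.
From mathcomp Require Import zify ring.
From mathcomp Require Import boolp classical_sets functions.

Set Implicit Arguments.
Unset Strict Implicit.
Unset Printing Implicit Defensive.

Import Order.TTheory GRing.Theory.
Local Open Scope ring_scope.

(** A relative cochain [g] can be moved past the idempotents [mor i i]. So on a composable chain
    from i to l, with at least one morphism, its value is a multiple of [mor i l], and in degree 0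
    its value is diagonal ([relative_mor], [relative_nil]). These scalars form a simplicial cochain,
    [chain_values g]. They determine [g]: S consists of all diagonal elements
    ([id_subalgebra_diagonal], [id_subalgebra_diag_sum]), which suffices to write every coefficient
    of [g] as a finite sum over chains ([relative_eq_chain_cochain]). Conversely, such sums always
    define a relative cochain ([chain_cochain_relative]). Hence Phi is bijective.

    On a chain, the inner cochain of a partial composition returns a scalar times the composite of
    its block. The outer cochain then sees the chain with the interior of the block deleted, which
    is the simplicial formula ([mor_value_insertion], [chain_values_comp]). The two multiplications
    correspond because morphisms compose ([phi_mult]). Brackets and differentials on both sides are
    built from these data by the same formulas, so Phi preserves them.

    The Lie axioms are computed on the simplicial side only: the associator of the circle product
    ([circ_assoc]) gives the pre-Lie identity ([scirc_prelie]), hence [simplicial_jacobi], and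
    [smult_assoc] supplies the axioms for d. [is_dgLie_transfer] carries them over. *)

(** * Signs *)

Section Sign.
Variable k : fieldType.

Lemma ksignD (m n : int) : ksign k (m + n) = ksign k m * ksign k n.
Proof. by rewrite /ksign expfzDr // oppr_eq0 oner_neq0. Qed.

Lemma ksign_mod2 (m n t : int) : m = n + 2 * t -> ksign k m = ksign k n.
Proof.
by move=> ->; rewrite ksignD /ksign -exprz_exp -exprnP sqrrN expr1n exp1rz mulr1.
Qed.

Lemma ksign_sqr (n : int) : ksign k n * ksign k n = 1.
Proof. by rewrite -ksignD (@ksign_mod2 _ 0 n) //; lia. Qed.

Lemma ksign_cases (n : int) : {ksign k n = 1} + {ksign k n = -1}.
Proof.
case: (eqVneq (ksign k n) 1) => [|h]; [by left|right].
have /eqP := ksign_sqr n; rewrite -expr2 sqrf_eq1 (negbTE h) /=.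
by move/eqP.
Qed.

End Sign.

(** * Nested and parallel insertions on vertex sequences *)

Section SeqInsertion.
Variable T : Type.
Implicit Types s : seq T.

Lemma nth_take_if x0 n s i :
  nth x0 (take n s) i = if (i < n)%N then nth x0 s i else x0.
Proof.
case: ltnP => h; first by rewrite nth_take.
by rewrite nth_default // size_take_min; lia.
Qed.

(* (f o_(j+1) g)(s) = f (contract j q s) * g (block j q s) for g of arity q.    *)
Definition contract (j q : nat) s := take j.+1 s ++ drop (j + q) s.
Definition block (j q : nat) s := take q.+1 (drop j s).

Lemma size_contract j q s : (j + q < size s)%N ->
  size (contract j q s) = (size s + 1 - q)%N.
Proof. rewrite size_cat size_take_min size_drop; lia. Qed.

Lemma eq_nth s1 s2 : size s1 = size s2 ->
  (forall x0 n, nth x0 s1 n = nth x0 s2 n) -> s1 = s2.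
Proof.
case: s1 => [|x0 s1] es h; first by case: s2 es {h}.
by apply: (@eq_from_nth _ x0).
Qed.

Ltac seq_nth :=
  apply: eq_nth => [|? ?]; rewrite /block /contract
    ?(nth_cat, nth_take_if, nth_drop, size_take_min, size_cat, size_drop);
  [lia | repeat case: ltnP => ?; try done; try lia; congr nth; lia].

Lemma contract_nested s i l q r : (l < q)%N -> (i + q + r <= size s)%N ->
  contract i q (contract (i + l) r s) = contract i (q + r).-1 s.
Proof. move=> lq h; seq_nth. Qed.

Lemma block_contract_nested s i l q r : (l < q)%N -> (i + q + r <= size s)%N ->
  block i q (contract (i + l) r s) = contract l r (block i (q + r).-1 s).
Proof. move=> lq h; seq_nth. Qed.

Lemma block_nested s i l q r : (l < q)%N -> (i + q + r <= size s)%N ->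
  block (i + l) r s = block l r (block i (q + r).-1 s).
Proof. move=> lq h; seq_nth. Qed.

Lemma contract_parallel s a b q r : (a < b)%N -> (b + q + r <= size s)%N ->
  contract a q (contract (b + q).-1 r s) = contract b r (contract a q s).
Proof. move=> ab h; seq_nth. Qed.

Lemma block_contract_parallel s a b q r : (a < b)%N -> (b + q + r <= size s)%N ->
  block a q (contract (b + q).-1 r s) = block a q s.
Proof. move=> ab h; seq_nth. Qed.

Lemma block_parallel s a b q r : (a < b)%N -> (b + q + r <= size s)%N ->
  block (b + q).-1 r s = block b r (contract a q s).
Proof. move=> ab h; seq_nth. Qed.

End SeqInsertion.

(** * The associator of the circle product *)

Section CircleProduct.
Variables (k : fieldType) (T : Type).
Implicit Types (F G H : seq T -> k) (v : seq T).

Definition circ_fun (p q : nat) F G v : k :=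
  \sum_(0 <= j < p) ksign k (j%:Z * (q%:Z - 1)) *
    (F (contract j q v) * G (block j q v)).

Lemma sum_nat_shift (a n : nat) (X : nat -> k) :
  \sum_(a <= j < a + n) X j = \sum_(0 <= l < n) X (a + l)%N.
Proof.
rewrite -{1}[a]add0n big_addn addKn; apply: eq_bigr => l _.
by rewrite addnC.
Qed.

(** G enters the earlier slot a and H the later slot b of F. Contracting the block of G first makes
    b the index of a slot of F. *)
Definition two_insertions (p q r : nat) F G H v : k :=
  \sum_(0 <= b < p) \sum_(0 <= a < b)
    ksign k (a%:Z * (q%:Z - 1) + b%:Z * (r%:Z - 1)) *
    (F (contract b r (contract a q v)) * H (block b r (contract a q v)) *
     G (block a q v)).

(** With G in slot i of F and H in slot j of the composite, H lands in F before G if j < i, inside G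
    if i <= j < i + q, and in F after G if i + q <= j. In the last case slot j is slot j - q + 1 of
    F, and this shift produces the sign (q - 1)(r - 1). *)
Lemma circ_fun_assoc (p q r : nat) F G H v :
  (0 < p)%N -> (p + q + r <= (size v).+1)%N ->
  circ_fun (p + q).-1 r (circ_fun p q F G) H v =
  circ_fun p (q + r).-1 F (circ_fun q r G H) v +
  two_insertions p r q F H G v +
  ksign k ((q%:Z - 1) * (r%:Z - 1)) * two_insertions p q r F G H v.
Proof.
move=> p0 hv.
pose X i j := ksign k (j%:Z * (r%:Z - 1)) * ksign k (i%:Z * (q%:Z - 1)) *
  (F (contract i q (contract j r v)) * G (block i q (contract j r v)) *
   H (block j r v)).
transitivity (\sum_(0 <= i < p) \sum_(0 <= j < (p + q).-1) X i j).
  rewrite exchange_big /=; apply: eq_bigr => j _.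
  rewrite /circ_fun mulr_suml mulr_sumr; apply: eq_bigr => i _.
  by rewrite /X; ring.
rewrite [X in X + _]addrC.
have -> : two_insertions p r q F H G v =
    \sum_(0 <= i < p) \sum_(0 <= j < i) X i j.
  apply: eq_bigr => i _; apply: eq_bigr => j _.
  by rewrite /X ksignD; ring.
have -> : circ_fun p (q + r).-1 F (circ_fun q r G H) v =
    \sum_(0 <= i < p) \sum_(i <= j < i + q) X i j.
  rewrite /circ_fun; apply: eq_big_nat => i ip.
  rewrite (sum_nat_shift i q) !mulr_sumr; apply: eq_big_nat => l lq.
  rewrite /X contract_nested ?block_contract_nested; try lia.
  rewrite -block_nested; try lia.
  have -> : ksign k (i%:Z * ((q + r).-1%:Z - 1)) =
    ksign k (i%:Z * (q%:Z - 1)) * ksign k (i%:Z * (r%:Z - 1)).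
    by rewrite -ksignD; congr (ksign k _); nia.
  have -> : (i + l)%:Z * (r%:Z - 1) = i%:Z * (r%:Z - 1) + l%:Z * (r%:Z - 1) by nia.
  by rewrite ksignD; ring.
have -> : ksign k ((q%:Z - 1) * (r%:Z - 1)) * two_insertions p q r F G H v =
    \sum_(0 <= i < p) \sum_(i + q <= j < (p + q).-1) X i j.
  have hexch : forall Y : nat -> nat -> k,
      \sum_(0 <= b < p) \sum_(0 <= a < b) Y a b =
      \sum_(0 <= a < p) \sum_(a.+1 <= b < p) Y a b.
    move=> Y; transitivity (\sum_(0 <= b < p) \sum_(0 <= a < p | (a < b)%N) Y a b).
      by apply: eq_big_nat => b bp; rewrite (big_nat_widen _ _ p) //; lia.
    rewrite (exchange_big_dep_nat predT) //=; apply: eq_bigr => a _.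
    by rewrite [RHS](big_nat_widenl _ 0).
  rewrite /two_insertions hexch mulr_sumr; apply: eq_big_nat => a ap.
  have ep : p = (a.+1 + (p - a.+1))%N by lia.
  have epq : (p + q).-1 = (a + q + (p - a.+1))%N by lia.
  rewrite epq {1}ep (sum_nat_shift a.+1) (sum_nat_shift (a + q)) mulr_sumr.
  apply: eq_big_nat => l lp.
  have -> : (a + q + l = (a.+1 + l + q).-1)%N by lia.
  rewrite /X contract_parallel ?block_contract_parallel; try lia.
  rewrite (@block_parallel _ v a); try lia.
  have -> : ksign k ((a.+1 + l + q).-1%:Z * (r%:Z - 1)) =
      ksign k ((q%:Z - 1) * (r%:Z - 1)) * ksign k ((a.+1 + l)%:Z * (r%:Z - 1)).
    by rewrite -ksignD; congr (ksign k _); nia.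
  by rewrite ksignD; ring.
rewrite -!big_split /=; apply: eq_big_nat => i ip.
rewrite (@big_cat_nat _ _ _ i) //=; last by lia.
by rewrite (@big_cat_nat _ _ _ (i + q) i) //= ?addrA //; lia.
Qed.

End CircleProduct.

(** * Simplicial cochains as functions on vertex sequences *)

Section SimplicialCochains.
Variables (k : fieldType) (d : Order.disp_t) (P : porderType d).
Implicit Types v : seq P.

Definition is_simplex (n : int) (v : seq P) : bool :=
  [&& v != [::], (size v)%:Z == n + 1 & sorted <=%O v].

Lemma simplexP n (v : simplex P n) : is_simplex n (\val v).
Proof. exact: (valP v). Qed.

Lemma sc_app_val n (f : scochain k P n) (v : simplex P n) : sc_app f (\val v) = f v.
Proof. by rewrite /sc_app valK. Qed.

Lemma sc_app_out n (f : scochain k P n) v : ~~ is_simplex n v -> sc_app f v = 0.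
Proof. by move=> h; rewrite /sc_app insubN. Qed.

Lemma sc_appP n (f : scochain k P n) (F : seq P -> k) :
  (forall v : simplex P n, f v = F (\val v)) ->
  forall v, is_simplex n v -> sc_app f v = F v.
Proof. by move=> h v hv; rewrite /sc_app insubT /= h. Qed.

Lemma sc_appD n (c : k) (f g : scochain k P n) v :
  sc_app (c *: f + g) v = c * sc_app f v + sc_app g v.
Proof. by rewrite /sc_app; case: insubP => //= _; rewrite mulr0 addr0. Qed.

Lemma sc_app0 n v : sc_app (0 : scochain k P n) v = 0.
Proof. by rewrite /sc_app; case: insubP. Qed.

Lemma scochain_neg n (f : scochain k P n) : n < 0 -> f = 0.
Proof.
move=> n0; apply/funext => v; exfalso; have /and3P[] := simplexP v.
by case: (\val v) => //= x s _; lia.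
Qed.

(** For q = 0 the contraction repeats the vertex at j, so reflexivity of the order enters as
    well. *)
Lemma sorted_contract j q v : sorted <=%O v -> sorted <=%O (contract j q v).
Proof.
case: v => [|x0 v] // sv; rewrite /contract.
apply/(sortedP x0) => i.
rewrite !(nth_cat, nth_take_if, nth_drop, size_take_min, size_cat, size_drop).
have h := sorted_leq_nth le_trans le_refl x0 sv.
move: h; move: (size (x0 :: v)) => N h.
by repeat case: ltnP => ?; move=> hi; try (exfalso; lia); apply: h; rewrite ?inE; lia.
Qed.

Lemma sorted_block j q v : sorted <=%O v -> sorted <=%O (block j q v).
Proof. by move=> sv; rewrite take_sorted ?drop_sorted. Qed.

Lemma is_simplex_contract j (q : nat) (n m : int) v :
  (j + q < size v)%N -> n + 1 = m + q%:Z ->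
  is_simplex n v -> is_simplex m (contract j q v).
Proof.
move=> h e /and3P[_ sv ov]; rewrite /is_simplex sorted_contract // andbT.
by rewrite -size_eq0 size_contract //; lia.
Qed.

Lemma is_simplex_block j (q : nat) (n : int) v : (j + q < size v)%N ->
  is_simplex n v -> is_simplex q (block j q v).
Proof.
move=> h /and3P[_ sv ov]; rewrite /is_simplex sorted_block // andbT.
by rewrite -size_eq0 /block size_takel ?size_drop; [apply/andP; split; lia | lia].
Qed.

Local Notation sC := (simplicial k P).

Lemma circ_simplicialE (p q r : int) (e : p + q = r + 1) (f : sC p) (g : sC q) v :
  is_simplex r v ->
  sc_app (circ e f g) v = circ_fun `|p| `|q| (sc_app f) (sc_app g) v.
Proof.
move=> vr; rewrite (@sc_appP r _ (circ_fun `|p| `|q| (sc_app f) (sc_app g))) //.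
move=> {vr}v; rewrite /circ /circ_fun fct_sumE big_mkord; apply: eq_bigr => j _.
(* For q < 0 the exponents of the two signs differ, but both terms vanish because g is 0. *)
have [q0|q0] := ltP q 0; last by rewrite gez0_abs.
rewrite (scochain_neg g q0) fctE /= /scomp !sc_app0 !mulr0. exact: scaler0.
Qed.

Lemma circ_linearl (p q r : int) (e : p + q = r + 1) (g : sC q) :
  linear (fun f : sC p => circ e f g).
Proof.
move=> c f f'; rewrite /circ scaler_sumr -big_split; apply: eq_bigr => j _ /=.
apply/funext => v; rewrite /= /scomp !fctE /= sc_appD.
by rewrite /GRing.scale /=; ring.
Qed.

Lemma circ_linearr (p q r : int) (e : p + q = r + 1) (f : sC p) :
  linear (fun g : sC q => circ e f g).
Proof.
move=> c g g'; rewrite /circ scaler_sumr -big_split; apply: eq_bigr => j _ /=.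
apply/funext => v; rewrite /= /scomp !fctE /= sc_appD.
by rewrite /GRing.scale /=; ring.
Qed.

End SimplicialCochains.

(** * The differential graded Lie algebra of simplicial cochains *)

Section SimplicialLie.
Variables (k : fieldType) (d : Order.disp_t) (P : porderType d).

Local Notation sC := (simplicial k P).

Lemma circ_0l (p q r : int) (e : p + q = r + 1) (g : sC q) : circ e (0 : sC p) g = 0.
Proof.
by have := circ_linearl e g (-1) 0 0; rewrite /= scaler0 addr0 scaleN1r addNr.
Qed.

Lemma circ_0r (p q r : int) (e : p + q = r + 1) (f : sC p) : circ e f (0 : sC q) = 0.
Proof.
by have := circ_linearr e f (-1) 0 0; rewrite /= scaler0 addr0 scaleN1r addNr.
Qed.

Lemma circ_arity0 (q r : int) (e : 0 + q = r + 1) (f : sC 0) (g : sC q) :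
  circ e f g = 0.
Proof. by rewrite /circ big_ord0. Qed.

Lemma eq_circ_fun (p q : nat) (F F' G G' : seq P -> k) v :
  (forall j, (j < p)%N -> F (contract j q v) = F' (contract j q v)) ->
  (forall j, (j < p)%N -> G (block j q v) = G' (block j q v)) ->
  circ_fun p q F G v = circ_fun p q F' G' v.
Proof. by move=> hF hG; apply: eq_big_nat => j jp; rewrite hF ?hG. Qed.

Lemma two_insertions_eq0 (p q r : nat) (F G H : seq P -> k) v :
  (forall x y z, F x * H y * G z = 0) -> two_insertions p q r F G H v = 0.
Proof.
move=> h; rewrite /two_insertions !big1 // => b _.
by rewrite big1 // => a _; rewrite h mulr0.
Qed.

Lemma circ_assoc (p q r pq qr t : int) (e1 : p + q = pq + 1) (e2 : pq + r = t + 1)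
    (e3 : q + r = qr + 1) (e4 : p + qr = t + 1) (f : sC p) (g : sC q) (h : sC r) v :
  is_simplex t v ->
  sc_app (circ e2 (circ e1 f g) h) v =
  sc_app (circ e4 f (circ e3 g h)) v +
  two_insertions `|p| `|r| `|q| (sc_app f) (sc_app h) (sc_app g) v +
  ksign k ((q - 1) * (r - 1)) *
    two_insertions `|p| `|q| `|r| (sc_app f) (sc_app g) (sc_app h) v.
Proof.
move=> vt.
have zero : f = 0 \/ g = 0 \/ h = 0 -> sc_app (circ e2 (circ e1 f g) h) v = 0 /\
    sc_app (circ e4 f (circ e3 g h)) v = 0.
  by case=> [->|[]->]; rewrite !(circ_0l, circ_0r, sc_app0).
case: (ltP p 0) => p0.
  have f0 := scochain_neg f p0.
  case: zero => [|-> ->]; first by left.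
  by rewrite !two_insertions_eq0 ?mulr0 ?addr0 // f0 => *; rewrite sc_app0 !mul0r.
case: (ltP q 0) => q0.
  have g0 := scochain_neg g q0.
  case: zero => [|-> ->]; first by right; left.
  by rewrite !two_insertions_eq0 ?mulr0 ?addr0 // g0 => *; rewrite sc_app0 ?mulr0 ?mul0r.
case: (ltP r 0) => r0.
  have h0 := scochain_neg h r0.
  case: zero => [|-> ->]; first by right; right.
  by rewrite !two_insertions_eq0 ?mulr0 ?addr0 // h0 => *; rewrite sc_app0 ?mulr0 ?mul0r.
case: p p0 f e1 e4 {zero} => // p _ f e1 e4.
case: q q0 g e1 e3 => // q _ g e1 e3.
case: r r0 h e2 e3 => // r _ h e2 e3.
case: p f e1 e4 => [|p] f e1 e4.
  by rewrite !circ_arity0 circ_0l sc_app0 /two_insertions !big_geq // mulr0 !addr0.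
have epq : pq = (p.+1 + q).-1%N by lia.
rewrite !circ_simplicialE //; subst pq.
have /and3P[_ /eqP sv _] := vt.
rewrite (eq_circ_fun (F' := circ_fun p.+1 q (sc_app f) (sc_app g))
  (G' := sc_app h)) //; last first.
  move=> j jp; rewrite circ_simplicialE //.
  by apply: is_simplex_contract vt => //; lia.
rewrite circ_fun_assoc //; last by lia.
congr (_ + _ + _).
(* For q = 0 the degree [qr] can be -1, whose absolute value is not [(q + r).-1]. Here the inner
   product of g and h is an empty sum, so both sides are 0. *)
case: q g e1 e2 e3 => [|q] g e1 e2 e3.
  have -> : circ e3 g h = 0 by rewrite circ_arity0.
  rewrite /circ_fun !big1 // => i _; first by rewrite sc_app0 !mulr0.
  by rewrite big_geq // !mulr0.
have eqr : qr = (q.+1 + r).-1%N by lia.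
subst qr; apply: eq_circ_fun => // j jp; rewrite circ_simplicialE //.
by apply: is_simplex_block vt; lia.
Qed.

(** The circle product without the equation between degrees as an argument: products reached through
    different degree proofs become syntactically equal. *)
Definition scirc (p q r : int) (f : scochain k P p) (g : scochain k P q) :
    scochain k P r :=
  fun v : simplex P r => circ_fun `|p| `|q| (sc_app f) (sc_app g) (\val v).
Arguments scirc {p q} r f g.

Lemma circ_scirc (p q r : int) (e : p + q = r + 1) (f : sC p) (g : sC q) :
  circ e f g = scirc r f g.
Proof.
apply/funext => v; rewrite -[LHS]sc_app_val circ_simplicialE //.
exact: simplexP.
Qed.

Lemma scirc_subZl (p q r : int) (e : p + q = r + 1) (c : k) (f f' : sC p) (g : sC q) :
  scirc r (f - c *: f') g = scirc r f g - c *: scirc r f' g.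
Proof.
by rewrite -!(circ_scirc e) addrC -scaleNr circ_linearl scaleNr addrC.
Qed.

Lemma scirc_subZr (p q r : int) (e : p + q = r + 1) (c : k) (f : sC p) (g g' : sC q) :
  scirc r f (g - c *: g') = scirc r f g - c *: scirc r f g'.
Proof.
by rewrite -!(circ_scirc e) addrC -scaleNr circ_linearr scaleNr addrC.
Qed.

(* In the associator of f, g, h the terms inserting h in g cancel; the others   *)
(* insert g and h in f at different places and are graded symmetric.            *)
Lemma scirc_prelie (a b c ab bc ac t : int) :
  a + b = ab -> b + c = bc -> a + c = ac -> a + b + c = t ->
  forall (f : sC (a + 1)) (g : sC (b + 1)) (h : sC (c + 1)) v,
  is_simplex (t + 1) v ->
  sc_app (scirc (t + 1) (scirc (ab + 1) f g) h) v -
    sc_app (scirc (t + 1) f (scirc (bc + 1) g h)) v =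
  ksign k (b * c) *
    (sc_app (scirc (t + 1) (scirc (ac + 1) f h) g) v -
     sc_app (scirc (t + 1) f (scirc (bc + 1) h g)) v).
Proof.
move=> eab ebc eac et f g h v vt.
have e1 : (a + 1) + (b + 1) = (ab + 1) + 1 by lia.
have e2 : (ab + 1) + (c + 1) = (t + 1) + 1 by lia.
have e3 : (b + 1) + (c + 1) = (bc + 1) + 1 by lia.
have e4 : (a + 1) + (bc + 1) = (t + 1) + 1 by lia.
have e5 : (a + 1) + (c + 1) = (ac + 1) + 1 by lia.
have e6 : (ac + 1) + (b + 1) = (t + 1) + 1 by lia.
have e7 : (c + 1) + (b + 1) = (bc + 1) + 1 by lia.
rewrite -(circ_scirc e1) -(circ_scirc e3) -(circ_scirc e5) -(circ_scirc e7).
rewrite -(circ_scirc e2) -!(circ_scirc e4) -(circ_scirc e6).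
rewrite (circ_assoc e1 e2 e3 e4) // (circ_assoc e5 e6 e7 e4) //.
by rewrite !addrK (mulrC c b); case: (ksign_cases k (b * c)) => ->; ring.
Qed.

Lemma simplicial_bracketE (a b c : int) (e : a + b = c)
    (f : shift sC a) (g : shift sC b) :
  gbracket e f g = scirc (c + 1) f g - ksign k (a * b) *: scirc (c + 1) g f.
Proof. by rewrite /gbracket !circ_scirc. Qed.

Lemma simplicial_jacobi (a b c ab bc ac t : int)
    (eab : a + b = ab) (ebc : b + c = bc) (eac : a + c = ac)
    (e1 : a + bc = t) (e2 : ab + c = t) (e3 : b + ac = t)
    (x : shift sC a) (y : shift sC b) (z : shift sC c) :
  gbracket e1 x (gbracket ebc y z) =
    gbracket e2 (gbracket eab x y) z +
    ksign k (a * b) *: gbracket e3 y (gbracket eac x z).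
Proof.
rewrite !simplicial_bracketE.
rewrite !(scirc_subZl, scirc_subZr); try lia.
apply/funext => v.
rewrite -[LHS]sc_app_val -[RHS]sc_app_val.
have subE n (f g : scochain k P n) r w :
    sc_app (f - r *: g) w = sc_app f w - r * sc_app g w.
  by rewrite addrC -scaleNr sc_appD mulNr addrC.
have addE n (f g : scochain k P n) r w :
    sc_app (f + r *: g) w = sc_app f w + r * sc_app g w.
  by rewrite addrC sc_appD addrC.
rewrite !subE.
(* The pre-Lie identity with each of x, y, z as outer factor eliminates (xy)z, (yx)z and (zx)y. What
   remains is an identity between signs, checked on all parities. *)
have h1 := @scirc_prelie a b c ab bc ac t
  ltac:(lia) ltac:(lia) ltac:(lia) ltac:(lia)
  x y z _ (simplexP v).
have h2 := @scirc_prelie b a c ab ac bc t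
  ltac:(lia) ltac:(lia) ltac:(lia) ltac:(lia)
  y x z _ (simplexP v).
have h3 := @scirc_prelie c a b ac ab bc t
  ltac:(lia) ltac:(lia) ltac:(lia) ltac:(lia)
  z x y _ (simplexP v).
rewrite addE !subE.
move/(canRL (subrK _)): h1 => ->; move/(canRL (subrK _)): h2 => ->.
move/(canRL (subrK _)): h3 => ->.
rewrite -ebc -eab -eac !mulrDl !mulrDr !ksignD (mulrC b a).
by case: (ksign_cases k (a * b)) => ->; case: (ksign_cases k (b * c)) => ->;
  case: (ksign_cases k (a * c)) => ->; ring.
Qed.

Lemma simplicial_diffE (a b : int) (e : a + 1 = b) (e' : 1 + a = b) (f : shift sC a) :
  gdiff e f = gbracket e' (op_mult sC : shift sC 1) f.
Proof. by rewrite simplicial_bracketE /gdiff !circ_scirc mul1r. Qed.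

(** Both partial compositions of the constant 1 with itself are 1, and they enter with opposite
    signs. *)
Lemma smult_assoc :
  scirc (2 + 1) (op_mult sC) (op_mult sC) = 0.
Proof.
apply/funext => v; rewrite /scirc /circ_fun !big_nat_recl // big_geq //=.
have sm w : is_simplex 2 w -> sc_app (op_mult sC) w = 1.
  exact: (@sc_appP _ _ _ _ _ (fun=> 1)).
have vt := simplexP v; have /and3P[_ /eqP sv _] := vt.
rewrite !sm; try by [apply: is_simplex_contract vt; lia
                    | apply: is_simplex_block vt; lia].
rewrite mul0r mul1r addr0 (_ : ksign k 0 = 1) // (_ : ksign k _ = -1) //.
by rewrite mulN1r mulr1 subrr.
Qed.

Hypothesis char0 : [pchar k] =i pred0.

Lemma simplicial_dgLie : is_dgLie (simplicial_dg k P).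
Proof.
have br_linl a b c (e : a + b = c) (y : shift sC b) :
    linear (fun x : shift sC a => gbracket e x y).
  move=> r f g; rewrite /gbracket circ_linearl circ_linearr.
  by rewrite scalerBr !scalerDr !scalerA mulrC opprD addrACA.
have br_linr a b c (e : a + b = c) (x : shift sC a) :
    linear (fun y : shift sC b => gbracket e x y).
  move=> r f g; rewrite /gbracket circ_linearl circ_linearr.
  by rewrite scalerBr !scalerDr !scalerA mulrC opprD addrACA.
split=> //=.
- move=> a b e r f g; rewrite !(@simplicial_diffE _ _ e (etrans (addrC _ _) e)).
  exact: br_linr.
- move=> a b c e e' x y; rewrite !simplicial_bracketE scalerBr scalerA (mulrC b a).
  by rewrite ksign_sqr scale1r opprB.
- exact: simplicial_jacobi.
- move=> a b c e e' x.
  have e1 : 1 + a = b by lia.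
  have e2 : 1 + b = c by lia.
  have e3 : (1 + 1 : int) = 2 by [].
  have e4 : (2 : int) + a = c by lia.
  rewrite (simplicial_diffE _ e2) (simplicial_diffE _ e1).
  pose m : shift sC 1 := op_mult sC.
  (* Since [m, m] = 0 and m has odd degree, Jacobi reads [m, [m, x]] = -[m, [m, x]]. Characteristic
     0 allows division by 2. *)
  have := simplicial_jacobi e3 e1 e1 e2 e4 e2 m m x.
  have -> : gbracket e3 m m = 0.
    by rewrite simplicial_bracketE [scirc _ _ _]smult_assoc scaler0 subr0.
  have -> : ksign k (1 * 1) = -1 by [].
  have /= := br_linl _ _ _ e4 x (-1) 0 0; rewrite scaler0 addr0 scaleN1r addNr => ->.
  set D := gbracket _ _ _; rewrite add0r scaleN1r => /eqP.
  rewrite -subr_eq0 opprK -mulr2n -scaler_nat scaler_eq0.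
  by rewrite (proj1 (pcharf0P k) char0) => /eqP.
- move=> a b c a' b' c' e ea eb ec e1 e2 x y.
  have f1 : 1 + a = a' by lia.
  have f2 : 1 + b = b' by lia.
  have f3 : 1 + c = c' by lia.
  rewrite (simplicial_diffE _ f1) (simplicial_diffE _ f2) (simplicial_diffE _ f3).
  by rewrite (simplicial_jacobi f1 e f2 f3 e1 e2) mul1r.
Qed.

End SimplicialLie.

(** * Coefficients and diagonal elements of the incidence algebra *)

Section Coefficients.
Variables (k : fieldType) (d : Order.disp_t) (P : porderType d).
Local Notation A := (incidence k P).
Local Notation mor := (@mor k d P).
Implicit Types (a b : A) (i j l : P).

Lemma icoef_mor i j i' j' : (i' <= j')%O ->
  icoef (mor i j) i' j' = ((i' == i) && (j' == j))%:R.
Proof. by move=> h; rewrite icoef_sum // xpair_eqE. Qed.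

Lemma icoef_mor_id i : icoef (mor i i) i i = 1.
Proof. by rewrite icoef_mor // eqxx. Qed.

Lemma icoef0 i j : icoef (0 : A) i j = 0.
Proof. by rewrite /icoef; case: insubP. Qed.

Lemma mor_eq0 i j : ~~ (i <= j)%O -> mor i j = 0.
Proof.
move=> h; apply: incidenceP => i' j' h'; rewrite icoef_mor //.
rewrite [RHS]icoef0; case: eqP => [ei|//]; case: eqP => [ej|//].
by rewrite ei ej (negbTE h) in h'.
Qed.

Lemma icoefB a b i j : icoef (a - b) i j = icoef a i j - icoef b i j.
Proof. by rewrite addrC -scaleN1r icoefD mulN1r addrC. Qed.

Lemma icoefZ c a i j : icoef (c *: a) i j = c * icoef a i j.
Proof. by rewrite -[c *: a]addr0 icoefD icoef0 addr0. Qed.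

Lemma icoef_bigsum (I : Type) (r : seq I) (a : I -> A) i j :
  icoef (\sum_(x <- r) a x) i j = \sum_(x <- r) icoef (a x) i j.
Proof.
apply: (big_morph (fun b : A => icoef b i j)) => [x y|]; last exact: icoef0.
by rewrite -[x]scale1r icoefD mul1r scale1r.
Qed.

Definition is_diagonal a : Prop := forall i j, i != j -> icoef a i j = 0.

Lemma diagonal_mor i : is_diagonal (mor i i).
Proof.
move=> j l jl; have [h|h] := boolP (j <= l)%O; last by rewrite icoef_out.
rewrite icoef_mor //; case: (eqVneq j i) => [ji|//]; case: eqP => // li.
by rewrite ji li eqxx in jl.
Qed.

Lemma diag_sum_diagonal r : is_diagonal (diag_sum r : A).
Proof.
move=> i j ij; have [h|h] := boolP (i <= j)%O; last by rewrite icoef_out.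
by rewrite icoef_sum // (negbTE ij).
Qed.

Lemma icoef_diag_sum r i : icoef (diag_sum r : A) i i = r i.
Proof. by rewrite icoef_sum // eqxx. Qed.

Lemma diagonal_eq a b : is_diagonal a -> is_diagonal b ->
  (forall i, icoef a i i = icoef b i i) -> a = b.
Proof.
move=> da db h; apply: incidenceP => i j _.
by case: (eqVneq i j) => [->|ij] //; rewrite da ?db.
Qed.

End Coefficients.

(** * Composition of morphisms and the subalgebra S *)

Section IncidenceAlgebra.
Variables (k : fieldType) (d : Order.disp_t) (P : porderType d).
Hypothesis lfP : locally_finite P.
Local Notation A := (incidence_alg k lfP).
Local Notation S := (@id_subalgebra k d P lfP).
Local Notation mor := (@Defs.mor k d P : P -> P -> A).
Local Open Scope kalg_scope.
Implicit Types (a b : A) (i j l : P).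

Lemma icoef_diagl b a i l : is_diagonal b ->
  icoef (b ** a) i l = icoef b i i * icoef a i l.
Proof.
move=> db; have [il|il] := boolP (i <= l)%O; last by rewrite !(icoef_out _ il) mulr0.
have [s us sil] := interval_seq lfP i l.
have si : i \in s by apply: sil; rewrite lexx il.
rewrite (icoef_mul _ _ il us) // (bigD1_seq i) //= big1 ?addr0 // => j ji.
by rewrite db ?mul0r // eq_sym.
Qed.

Lemma icoef_diagr b a i l : is_diagonal b ->
  icoef (a ** b) i l = icoef a i l * icoef b l l.
Proof.
move=> db; have [il|il] := boolP (i <= l)%O; last by rewrite !(icoef_out _ il) mul0r.
have [s us sil] := interval_seq lfP i l.
have sl : l \in s by apply: sil; rewrite lexx il.
rewrite (icoef_mul _ _ il us) // (bigD1_seq l) //= big1 ?addr0 // => j jl.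
by rewrite db ?mulr0.
Qed.

Lemma mor_comp i j l : (i <= j)%O -> (j <= l)%O -> mor i j ** mor j l = mor i l.
Proof.
move=> ij jl; apply: incidenceP => i' l' il'; rewrite [RHS]icoef_mor //.
have [s us sil] := interval_seq lfP i' l'.
rewrite (icoef_mul _ _ il' us) //.
case: (eqVneq i' i) => [ei|ni]; last first.
  rewrite big1 // => x _; have [h|h] := boolP (i' <= x)%O;
    last by rewrite icoef_out ?mul0r.
  by rewrite icoef_mor // (negbTE ni) mul0r.
case: (eqVneq l' l) => [el|nl]; last first.
  rewrite big1 // => x _; have [h|h] := boolP (x <= l')%O;
    last by rewrite [X in _ * X]icoef_out ?mulr0.
  by rewrite [X in _ * X]icoef_mor // (negbTE nl) andbF mulr0.
subst i' l'; have sj : j \in s by apply: sil; rewrite ij jl.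
rewrite (bigD1_seq j) //= !icoef_mor // !eqxx mul1r big1 ?addr0 // => x xj.
have [h|h] := boolP (i <= x)%O; last by rewrite icoef_out ?mul0r.
by rewrite icoef_mor // (negbTE xj) andbF mul0r.
Qed.

Lemma mor_idr i j : mor i j ** mor j j = mor i j.
Proof.
have [h|h] := boolP (i <= j)%O; first exact: mor_comp.
by rewrite mor_eq0 // ka_mul0l.
Qed.

Lemma id_subalgebra_mor i : S (mor i i).
Proof. by move=> U [_ hU]; apply: hU; exists i. Qed.

(** The diagonal elements form a formally closed subalgebra containing the [mor i i], and S is the
    smallest such. *)
Lemma id_subalgebra_diagonal a : S a -> is_diagonal a.
Proof.
move=> Sa; apply: (Sa (fun x : A => is_diagonal x)); split; last first.
  by move=> _ [i _ <-]; exact: diagonal_mor.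
split; first split.
- move=> i j ij; have [h|h] := boolP (i <= j)%O; last by rewrite icoef_out.
  by rewrite icoef_sum // (negbTE ij).
- by move=> c x y hx hy i j ij; rewrite icoefD hx // hy // mulr0 addr0.
- by move=> x y hx hy i j ij; rewrite icoef_diagl // hy // mulr0.
- move=> x hx i j ij; have [u hu] := hx [:: (i, j)].
  by move=> /(_ (i, j)) /=; rewrite inE eqxx => <- //; exact: hu.
Qed.

(** On a finite set of index pairs, [diag_sum r] agrees with a finite combination of the [mor x x],
    x running over the first components; formal closedness does the rest. *)
Lemma id_subalgebra_diag_sum r : S (diag_sum r).
Proof.
move=> U [[[U1 UD _] Uf] UE]; apply: Uf => s.
have U0 : U 0 by have := UD (-1) _ _ U1 U1; rewrite scaleN1r addNr.
exists (\sum_(x <- undup (map fst s)) r x *: mor x x).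
  elim: (undup _) => [|x t IH]; first by rewrite big_nil.
  by rewrite big_cons; apply: UD => //; apply: UE; exists x.
move=> [i j] ijs /=; rewrite icoef_bigsum.
have [h|h] := boolP (i <= j)%O; last first.
  by rewrite icoef_out // big1 // => x _; rewrite icoef_out.
have si : i \in undup (map fst s) by rewrite mem_undup; apply/mapP; exists (i, j).
rewrite (bigD1_seq i) ?undup_uniq //= icoefZ icoef_mor // eqxx /=.
rewrite icoef_sum // eq_sym; rewrite big1 ?addr0; last first.
  by move=> x xi; rewrite icoefZ icoef_mor // eq_sym (negbTE xi) mulr0.
by case: eqP; rewrite ?mulr1 ?mulr0.
Qed.

End IncidenceAlgebra.

Lemma pairmap_rcons (T1 T2 : Type) (f : T1 -> T1 -> T2) x s y :
  pairmap f x (rcons s y) = rcons (pairmap f x s) (f (last x s) y).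
Proof. by rewrite -!cats1 pairmap_cat. Qed.

Lemma path_le_last (d : Order.disp_t) (P : porderType d) (i : P) p :
  path <=%O i p -> (i <= last i p)%O.
Proof. by elim: p i => //= x p IH i /andP[ix /IH]; exact: le_trans. Qed.

(** * Relative cochains are determined by their values on chains *)

Section RelativeCochains.
Variables (k : fieldType) (d : Order.disp_t) (P : porderType d).
Hypothesis lfP : locally_finite P.
Local Notation A := (incidence_alg k lfP).
Local Notation S := (@id_subalgebra k d P lfP).
Local Notation mor := (@Defs.mor k d P : P -> P -> A).
Local Open Scope kalg_scope.

(** For a relative [g] and at least one morphism, this is the only coefficient of the value that can
    be nonzero. *)
Definition mor_value (g : seq A -> A) (v : seq P) : k :=
  if v is i :: p then icoef (g (pairmap mor i p)) i (last i p) else 0.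

Definition interval_enum (i l : P) : seq P := s2val (cid2 (interval_seq lfP i l)).

Lemma interval_enum_uniq i l : uniq (interval_enum i l).
Proof. exact: (s2valP (cid2 (interval_seq lfP i l))). Qed.

Lemma mem_interval_enum i l j : (i <= j)%O -> (j <= l)%O -> j \in interval_enum i l.
Proof.
by move=> ij jl; apply: (s2valP' (cid2 (interval_seq lfP i l))); rewrite ij jl.
Qed.

(* The sum of F(i, j_1, .., j_n) a_1(i, j_1) .. a_n(j_(n-1), j_n) over all     *)
(* j_1, .., j_n = l; only chains contribute, the other coefficients being 0.   *)
Fixpoint chain_sum (F : seq P -> k) (i : P) (s : seq A) (l : P) : k :=
  if s is a :: s' then
    \sum_(j <- interval_enum i l) icoef a i j * chain_sum (fun v => F (i :: v)) j s' l
  else (i == l)%:R * F [:: i].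

Lemma eq_chain_sum F F' i s l : F =1 F' -> chain_sum F i s l = chain_sum F' i s l.
Proof.
elim: s F F' i => [|a s IH] F F' i h /=; first by rewrite h.
by apply: eq_bigr => j _; congr (_ * _); apply: IH => v; rewrite h.
Qed.

Lemma chain_sum_eq0 F i s l : (forall v, size v = (size s).+1 -> F v = 0) ->
  chain_sum F i s l = 0.
Proof.
elim: s F i => [|a s IH] F i h /=; first by rewrite h // mulr0.
by rewrite big1 // => j _; rewrite IH ?mulr0 // => v sv; rewrite h //= sv.
Qed.

Lemma chain_sumD (F F' : seq P -> k) c i s l :
  chain_sum (fun v => c * F v + F' v) i s l = c * chain_sum F i s l + chain_sum F' i s l.
Proof.
elim: s F F' i => [|a s IH] F F' i /=; first by ring.
rewrite mulr_sumr -big_split; apply: eq_bigr => j _ /=.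
by rewrite (IH (fun v => F (i :: v))); ring.
Qed.

Lemma chain_sum_mor F i p : path <=%O i p ->
  chain_sum F i (pairmap mor i p) (last i p) = F (i :: p).
Proof.
elim: p F i => [|x p IH] F i /=; first by rewrite eqxx mul1r.
move=> /andP[ix xp]; rewrite (bigD1_seq x) ?interval_enum_uniq //=; last first.
  exact/mem_interval_enum/path_le_last.
rewrite icoef_mor // !eqxx mul1r IH // big1 ?addr0 // => j jx.
have [h|h] := boolP (i <= j)%O; last by rewrite icoef_out // mul0r.
by rewrite icoef_mor // (negbTE jx) andbF mul0r.
Qed.

(** The multilinear extension of prescribed values on chains; with F a simplicial cochain it is the
    image under Phi. *)
Definition chain_cochain (F : seq P -> k) (s : seq A) : A :=
  formal_sum (fun i l => chain_sum F i s l).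

Lemma icoef_chain_cochain F s i l : (i <= l)%O ->
  icoef (chain_cochain F s) i l = chain_sum F i s l.
Proof. exact: icoef_sum. Qed.

(** Every b in S is diagonal. Placed next to an argument, it multiplies each term of the chain sum
    by its diagonal entry at the vertex where it stands, on whichever side it is absorbed. *)
Lemma chain_cochain_relative F : relative S (chain_cochain F).
Proof.
split.
- move=> s1 s2 c x y; apply: incidenceP => i l il.
  rewrite icoefD !icoef_chain_cochain //.
  elim: s1 F i {il} => [|a s1 IH] F i /=; rewrite mulr_sumr -big_split;
    apply: eq_bigr => j _ /=.
    by rewrite icoefD; ring.
  by rewrite IH; ring.
- move=> b /id_subalgebra_diagonal db; apply: diagonal_eq => [i j ij|i j ij|i].
  + rewrite icoef_diagr //; have [h|h] := boolP (i <= j)%O;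
      last by rewrite icoef_out ?mul0r.
    by rewrite icoef_chain_cochain //= (negbTE ij) !mul0r.
  + rewrite icoef_diagl //; have [h|h] := boolP (i <= j)%O;
      last by rewrite [X in _ * X]icoef_out ?mulr0.
    by rewrite icoef_chain_cochain //= (negbTE ij) mul0r mulr0.
  + by rewrite (icoef_diagl _ _ _ db) (icoef_diagr _ _ _ db) mulrC.
- move=> a b s /id_subalgebra_diagonal db; apply: incidenceP => i l il.
  rewrite icoef_diagl // !icoef_chain_cochain //= mulr_sumr.
  by apply: eq_bigr => j _; rewrite icoef_diagl // mulrA.
- move=> a b a' s1 s2 /id_subalgebra_diagonal db; apply: incidenceP => i l il.
  rewrite !icoef_chain_cochain //.
  elim: s1 F i {il} => [|a0 s1 IH] F i /=; apply: eq_bigr => j _; last by rewrite IH.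
  rewrite icoef_diagr // -mulrA; congr (_ * _); rewrite mulr_sumr.
  by apply: eq_bigr => m _; rewrite icoef_diagl // mulrA.
- move=> a b s /id_subalgebra_diagonal db; apply: incidenceP => i l il.
  rewrite icoef_diagr // !icoef_chain_cochain //.
  elim: s F i {il} => [|a0 s IH] F i /=; rewrite mulr_suml;
    apply: eq_bigr => j _; last first.
    by rewrite IH mulrA.
  by rewrite icoef_diagr //; case: eqP => [->|_];
    rewrite ?(mul1r, mul0r, mulr0) // mulrAC.
Qed.

Section Relative.
Variable (g : seq A -> A).
Hypothesis gS : relative S g.

Lemma relative0 u s : g (u ++ 0 :: s) = 0.
Proof.
by have := rel_lin gS u s (-1) 0 0; rewrite scaler0 addr0 scaleN1r addNr.
Qed.

Lemma relative_sum (I : Type) (r : seq I) (c : I -> k) (x : I -> A) y u s :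
  g (u ++ (\sum_(i <- r) c i *: x i + y) :: s) =
  \sum_(i <- r) c i *: g (u ++ x i :: s) + g (u ++ y :: s).
Proof.
elim: r => [|i r IH]; first by rewrite !big_nil !add0r.
by rewrite !big_cons -!addrA (rel_lin gS) IH.
Qed.

(* As b is b times the idempotent of {m | ~ m <= l}, which lies in S, the      *)
(* next argument may be multiplied by it, and then its columns m <= l are 0.    *)
Lemma relative_vanish (b : A) u s i l : (forall j m, (m <= l)%O -> icoef b j m = 0) ->
  icoef (g (u ++ b :: s)) i l = 0.
Proof.
elim: s u b => [|a s IH] u b hb.
  rewrite cats1 -[LHS]mulr1 -(icoef_mor_id k l) -icoef_diagr; last exact: diagonal_mor.
  rewrite -(rel_r gS); last exact: id_subalgebra_mor.
  suff -> : b ** mor l l = 0 by rewrite -cats1 relative0 icoef0.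
  apply: incidenceP => j m _; rewrite icoef_diagr; last exact: diagonal_mor.
  rewrite icoef0; case: (eqVneq m l) => [->|ml]; first by rewrite hb // mul0r.
  by rewrite icoef_mor // (negbTE ml) mulr0.
pose D : A := diag_sum (fun m => (~~ (m <= l)%O)%:R).
have dD : is_diagonal D by exact: diag_sum_diagonal.
have -> : b = b ** D.
  apply: incidenceP => j m jm; rewrite icoef_diagr // icoef_diag_sum.
  by have [ml|ml] := boolP (m <= l)%O; [rewrite hb ?mul0r | rewrite mulr1].
rewrite (rel_m gS); last exact: id_subalgebra_diag_sum.
rewrite -cat_rcons; apply: IH => j m ml; rewrite icoef_diagl // icoef_diag_sum.
have [jm|jm] := boolP (j <= m)%O; last by rewrite icoef_out ?mulr0.
by rewrite (le_trans jm ml) mul0r.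
Qed.

(** The last morphism absorbs the idempotent of its target, which then leaves [g] on the right. In
    degree 0, [g [::]] commutes with the idempotent of l instead. *)
Lemma relative_chain_col i p l : l != last i p -> icoef (g (pairmap mor i p)) i l = 0.
Proof.
case/lastP: p => [|p x]; rewrite /= ?last_rcons => h.
  have := rel_0 gS (@id_subalgebra_mor k _ _ lfP l).
  move=> /(congr1 (fun a : A => icoef a i l)).
  have dl := @diagonal_mor k _ P l.
  rewrite (icoef_diagl _ _ _ dl) (icoef_diagr _ _ _ dl) icoef_mor_id mulr1 => ->.
  by rewrite icoef_mor // eq_sym (negbTE h) mul0r.
rewrite pairmap_rcons -mor_idr (rel_r gS); last exact: id_subalgebra_mor.
by rewrite icoef_diagr; [rewrite icoef_mor // (negbTE h) mulr0|exact: diagonal_mor].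
Qed.

Lemma relative_chain_row i x p j l : j != i -> icoef (g (pairmap mor i (x :: p))) j l = 0.
Proof.
move=> h /=; have -> : mor i x = mor i i ** mor i x.
  have [ix|ix] := boolP (i <= x)%O; first by rewrite mor_comp.
  by rewrite mor_eq0 // ka_mul0r.
rewrite (rel_l gS); last exact: id_subalgebra_mor.
by rewrite icoef_diagl; [rewrite icoef_mor // (negbTE h) mul0r|exact: diagonal_mor].
Qed.

(** The inserted idempotent is split off from the last morphism of the chain; for an empty chain it
    is the projection onto the row i being read. *)
Lemma relative_left i p (a : A) s l :
  icoef (g (pairmap mor i p ++ a :: s)) i l =
  icoef (g (pairmap mor i p ++ mor (last i p) (last i p) ** a :: s)) i l.
Proof.
case/lastP: p => [|p x] /=.
  rewrite (rel_l gS); last exact: id_subalgebra_mor.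
  by rewrite icoef_diagl ?icoef_mor_id ?mul1r //; exact: diagonal_mor.
rewrite last_rcons pairmap_rcons !cat_rcons -(rel_m gS) ?mor_idr //.
exact: id_subalgebra_mor.
Qed.

(* Only the row [last i p] of a matters; its nonzero entries outside the        *)
(* interval lie in columns m with ~ m <= l, so [relative_vanish] kills them.    *)
Lemma relative_expand i p (a : A) s l :
  icoef (g (pairmap mor i p ++ a :: s)) i l =
  \sum_(j <- interval_enum (last i p) l) icoef a (last i p) j *
    icoef (g (pairmap mor i p ++ mor (last i p) j :: s)) i l.
Proof.
set m := last i p; pose r := interval_enum m l.
pose y := mor m m ** a - \sum_(j <- r) icoef a m j *: mor m j.
have -> : icoef (g (pairmap mor i p ++ a :: s)) i l =
    icoef (g (pairmap mor i p ++ (\sum_(j <- r) icoef a m j *: mor m j + y) :: s)) i l.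
  by rewrite relative_left [in RHS]addrC subrK.
rewrite relative_sum -[X in X + _]scale1r icoefD mul1r icoef_bigsum.
rewrite [X in _ + X]relative_vanish ?addr0.
  by apply: eq_bigr => j _; rewrite icoefZ.
move=> x z zl; rewrite icoefB icoef_bigsum icoef_diagl; last exact: diagonal_mor.
have [xz|xz] := boolP (x <= z)%O; last first.
  by rewrite (icoef_out _ xz) mulr0 big1 ?subr0 // => j _; rewrite icoef_out.
under eq_bigr do rewrite icoefZ icoef_mor //.
rewrite icoef_mor // andbb; case: (eqVneq x m) => [xm|xm]; last first.
  by rewrite mul0r big1 ?subr0 // => j _; rewrite /= mulr0.
rewrite (bigD1_seq z) ?interval_enum_uniq ?mem_interval_enum -?xm //= eqxx mul1r mulr1.
by rewrite big1 ?addr0 ?subrr // => j jz; rewrite eq_sym (negbTE jz) mulr0.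
Qed.

(** Induction on s: [relative_expand] replaces the first arbitrary argument by morphisms extending
    the chain p. The prefix is [belast i p] because [chain_sum] itself adds the current vertex. *)
Lemma relative_chain_sum i p s l :
  icoef (g (pairmap mor i p ++ s)) i l =
  chain_sum (fun v => mor_value g (belast i p ++ v)) (last i p) s l.
Proof.
elim: s p => [|a s IH] p /=.
  rewrite cats0 cats1 -lastI /=; case: eqP => [<-|/eqP h]; first by rewrite mul1r.
  by rewrite mul0r relative_chain_col // eq_sym.
rewrite relative_expand; apply: eq_bigr => j _; congr (_ * _).
rewrite -cat_rcons -pairmap_rcons IH last_rcons belast_rcons.
by apply: eq_chain_sum => v; rewrite -cat_rcons -lastI.
Qed.

Lemma relative_eq_chain_cochain : g = chain_cochain (mor_value g).
Proof.
apply/funext => s; apply: incidenceP => i l il; rewrite icoef_chain_cochain //.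
by rewrite (relative_chain_sum i [::]).
Qed.

(** Some consecutive pair is not ordered, so the corresponding argument [mor] is 0. *)
Lemma mor_value_unsorted v : ~~ sorted <=%O v -> mor_value g v = 0.
Proof.
case: v => //= i p h.
suff [s1 [s2 ->]] : exists s1 s2, pairmap mor i p = s1 ++ 0 :: s2.
  by rewrite relative0 icoef0.
elim: p i h => //= x p IH i; rewrite negb_and.
have [ix /=|ix _] := boolP (i <= x)%O; last first.
  by exists [::], (pairmap mor x p); rewrite mor_eq0.
by move=> /IH[s1 [s2 ->]]; exists (mor i x :: s1), s2.
Qed.

Lemma relative_mor i x p :
  g (pairmap mor i (x :: p)) = mor_value g (i :: x :: p) *: mor i (last x p).
Proof.
apply: incidenceP => j l jl; rewrite icoefZ icoef_mor //.
case: (eqVneq j i) => [->|ji]; last by rewrite relative_chain_row ?mulr0.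
case: (eqVneq l (last x p)) => [->|h]; first by rewrite mulr1.
by rewrite relative_chain_col ?mulr0.
Qed.

Lemma relative_nil : g [::] = diag_sum (fun i => mor_value g [:: i]).
Proof.
apply: diagonal_eq; [|exact: diag_sum_diagonal|].
  by move=> i j ij; apply: (@relative_chain_col i [::]); rewrite eq_sym.
by move=> i; rewrite icoef_diag_sum.
Qed.

End Relative.
End RelativeCochains.
Arguments chain_cochain {k d P} lfP F s.

(** * Transport of structure along maps *)

(** Every element of M is an image, so each axiom of M is the image of the same axiom of L. *)
Lemma is_dgLie_transfer (k : fieldType) (L M : dgData k) (phi : forall a, L a -> M a) :
  is_dgLie L -> (forall a, linear (phi a)) -> (forall a, bijective (phi a)) ->
  (forall a b c (e : a + b = c) (x : L a) (y : L b),
    phi c (dg_br e x y) = dg_br e (phi a x) (phi b y)) ->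
  (forall a b (e : a + 1 = b) (x : L a), phi b (dg_d e x) = dg_d e (phi a x)) ->
  is_dgLie M.
Proof.
move=> [Ll Lr dl anti jac dd leib] lin bij br df.
have ex a (y : M a) : exists x, phi a x = y.
  by have [psi _ psiK] := bij a; exists (psi y).
have D a (x y : L a) : phi a x + phi a y = phi a (x + y).
  by have := lin a 1 x y; rewrite !scale1r.
have Z a c (x : L a) : c *: phi a x = phi a (c *: x).
  have := lin a c x 0; rewrite addr0 => ->.
  by have := lin a (-1) 0 0; rewrite scaler0 addr0 scaleN1r addNr => ->; rewrite addr0.
have N a (x : L a) : - phi a x = phi a (- x) by rewrite -!scaleN1r Z.
have O a : 0 = phi a 0 by rewrite -(scale0r (phi a 0)) Z scaler0.
split.
- move=> a b c e y r x1 x2;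
  have [[[y' <-] [x1' <-]] [x2' <-]] := (ex _ y, ex _ x1, ex _ x2).
  by rewrite !(Z, D, =^~ br) Ll.
- move=> a b c e x r y1 y2;
  have [[[x' <-] [y1' <-]] [y2' <-]] := (ex _ x, ex _ y1, ex _ y2).
  by rewrite !(Z, D, =^~ br) Lr.
- move=> a b e r x1 x2; have [[x1' <-] [x2' <-]] := (ex _ x1, ex _ x2).
  by rewrite !(Z, D, =^~ df) dl.
- move=> a b c e e' x y; have [[x' <-] [y' <-]] := (ex _ x, ex _ y).
  by rewrite -!br Z N (anti _ _ _ e e').
- move=> a b c ab bc ac t eab ebc eac e1 e2 e3 x y z.
  have [[[x' <-] [y' <-]] [z' <-]] := (ex _ x, ex _ y, ex _ z).
  by rewrite -!br Z D (jac _ _ _ _ _ _ _ eab ebc eac e1 e2 e3).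
- move=> a b c e e' x; have [x' <-] := ex _ x.
  by rewrite -!df dd -O.
- move=> a b c a' b' c' e ea eb ec e1 e2 x y; have [[x' <-] [y' <-]] := (ex _ x, ex _ y).
  by rewrite -!(br, df) Z D (leib _ _ _ _ _ _ e ea eb ec e1 e2).
Qed.

Section OpMorphism.
Variables (k : fieldType) (C D : opData k) (phi : forall n, C n -> D n).
Hypothesis phi_linear : forall n, linear (phi (n := n)).
Hypothesis phi_comp : forall (p q r : int) (e : p + q = r + 1) j (f : C p) (g : C q),
  phi (op_comp e j f g) = op_comp e j (phi f) (phi g).
Hypothesis phi_mult : phi (op_mult C) = op_mult D.

Let phiD n (x y : C n) : phi (x + y) = phi x + phi y.
Proof. by have := phi_linear 1 x y; rewrite !scale1r. Qed.

Let phi0 n : phi (0 : C n) = 0.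
Proof. by have := phi_linear (-1) (0 : C n) 0; rewrite scaler0 addr0 scaleN1r addNr. Qed.

Let phiZ n c (x : C n) : phi (c *: x) = c *: phi x.
Proof. by rewrite -[c *: x]addr0 phi_linear phi0 addr0. Qed.

Let phiB n (x y : C n) : phi (x - y) = phi x - phi y.
Proof. by rewrite phiD -!scaleN1r phiZ. Qed.

Lemma op_morphism_circ (p q r : int) (e : p + q = r + 1) (f : C p) (g : C q) :
  phi (circ e f g) = circ e (phi f) (phi g).
Proof.
rewrite /circ (big_morph (phi (n := r)) (@phiD r) (@phi0 r)).
by apply: eq_bigr => j _; rewrite phiZ phi_comp.
Qed.

Lemma op_morphism_bracket a b c (e : a + b = c) (f : shift C a) (g : shift C b) :
  phi (gbracket e f g) = gbracket e (phi f : shift D a) (phi g : shift D b).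
Proof. by rewrite /gbracket phiB phiZ !op_morphism_circ. Qed.

Lemma op_morphism_diff a b (e : a + 1 = b) (f : shift C a) :
  phi (gdiff e f) = gdiff e (phi f : shift D a).
Proof. by rewrite /gdiff phiB phiZ !op_morphism_circ phi_mult. Qed.

End OpMorphism.

Lemma drop_size_last (T : Type) (x : T) s1 s2 :
  drop (size s1) (x :: s1 ++ s2) = last x s1 :: s2.
Proof. by rewrite -cat_cons lastI cat_rcons drop_size_cat ?size_belast. Qed.

(** * The isomorphism Phi and its compatibility with compositions *)

Section Phi.
Variables (k : fieldType) (d : Order.disp_t) (P : porderType d).
Hypothesis lfP : locally_finite P.
Local Notation A := (incidence_alg k lfP).
Local Notation S := (@id_subalgebra k d P lfP).
Local Notation mor := (@Defs.mor k d P : P -> P -> A).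

Lemma relcochain_inj n (f g : relcochain S n) : rc_app f = rc_app g -> f = g.
Proof.
move=> h; apply: val_inj; apply/funext => s.
by have := congr1 (fun F => F (\val s)) h; rewrite /rc_app /happ valK.
Qed.

Lemma rc_appD n (c : k) (f g : relcochain S n) s :
  rc_app (c *: f + g) s = c *: rc_app f s + rc_app g s.
Proof.
rewrite /rc_app; have -> : rc_fun (c *: f + g) = c *: rc_fun f + rc_fun g.
  by [].

by rewrite happD.
Qed.

Definition chain_values n (g : relcochain S n) : scochain k P n :=
  fun v : simplex P n => mor_value (rc_app g) (\val v).

(** Off the n-simplices both sides are 0: for a wrong length because [rc_app] extends by 0, for
    unsorted vertices by [mor_value_unsorted]. *)
Lemma sc_app_chain_values n (g : relcochain S n) :
  sc_app (chain_values g) = mor_value (rc_app g).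
Proof.
apply/funext => v; have [vn|vn] := boolP (is_simplex n v).
  by rewrite (sc_appP (F := mor_value (rc_app g))).
rewrite sc_app_out //; move: vn; rewrite !negb_and negbK => /or3P[/eqP->//|h|h].
  case: v h => //= i p h; rewrite /rc_app happ_out ?icoef0 // size_pairmap.
  by apply: contraNneq h => <-; rewrite -addn1 PoszD.
by rewrite mor_value_unsorted //; exact: rc_relative.
Qed.

Definition phi_fun n (f : scochain k P n) : args A n -> A :=
  fun s => chain_cochain lfP (sc_app f) (\val s).

Lemma happ_phi_fun n (f : scochain k P n) :
  happ (phi_fun f) = chain_cochain lfP (sc_app f).
Proof.
apply/funext => s; rewrite /happ; case: insubP => [t _ <- //|sn] /=.
apply: incidenceP => i l il; rewrite icoef_chain_cochain // icoef0 chain_sum_eq0 //.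
move=> v sv; apply: sc_app_out; rewrite /is_simplex sv.
by apply: contra sn => /and3P[_ /eqP h _]; lia.
Qed.

Fact phi_relative n (f : scochain k P n) : phi_fun f \in @relcochain_pred k A S n.
Proof. by apply/asboolP; rewrite happ_phi_fun; exact: chain_cochain_relative. Qed.

Definition phi n (f : scochain k P n) : relcochain S n := RelCochain (phi_relative f).

Lemma rc_app_phi n (f : scochain k P n) : rc_app (phi f) = chain_cochain lfP (sc_app f).
Proof. exact: happ_phi_fun. Qed.

Lemma phiK n : cancel (@phi n) (@chain_values n).
Proof.
move=> f; apply/funext => v; rewrite /chain_values rc_app_phi -[RHS]sc_app_val.
have /and3P[] := simplexP v; case: (\val v) => //= i p _ _ ip.
rewrite icoef_chain_cochain ?chain_sum_mor //.
exact: path_le_last.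
Qed.

Lemma chain_valuesK n : cancel (@chain_values n) (@phi n).
Proof.
move=> g; apply: relcochain_inj; rewrite rc_app_phi sc_app_chain_values.
by rewrite -relative_eq_chain_cochain //; exact: rc_relative.
Qed.

Lemma chain_values_inj n : injective (@chain_values n).
Proof. exact: can_inj (@chain_valuesK n). Qed.

Lemma phi_linear n : linear (@phi n).
Proof.
move=> c f g; apply: relcochain_inj; apply/funext => s.
rewrite rc_appD !rc_app_phi; apply: incidenceP => i l il.
rewrite icoefD !icoef_chain_cochain // -chain_sumD.
by apply: eq_chain_sum => v; rewrite sc_appD.
Qed.

(** Expand the argument filled by G into morphisms starting at [last i p1]: by [relative_chain_col],
    only the one ending at [last i (p1 ++ p2)] survives. This also covers empty [p2], that is, G of
    arity 0. *)
Lemma mor_value_insertion (F G : seq A -> A) i p1 p2 p3 :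
  relative S F -> relative S G -> path <=%O i (p1 ++ p2 ++ p3) ->
  icoef (F (pairmap mor i p1 ++ G (pairmap mor (last i p1) p2) ::
            pairmap mor (last i (p1 ++ p2)) p3)) i (last i (p1 ++ p2 ++ p3)) =
  mor_value F (i :: p1 ++ last i (p1 ++ p2) :: p3) * mor_value G (last i p1 :: p2).
Proof.
move=> FS GS; rewrite !cat_path => /and3P[ip1 ip2 ip3].
rewrite relative_expand // !last_cat; set x := last i p1; set y := last x p2.
rewrite (bigD1_seq y) ?interval_enum_uniq ?mem_interval_enum ?path_le_last //=.
rewrite big1 ?addr0 => [|j jy]; last by rewrite relative_chain_col ?mul0r.
by rewrite mulrC pairmap_cat last_cat.
Qed.

Lemma rc_app_hcomp (p q r : int) (e : p + q = r + 1) (j : 'I_`|p|)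
    (f : relcochain S p) (g : relcochain S q) s : (size s)%:Z = r ->
  rc_app (hcomp e j f g) s =
  rc_app f (take j s ++ rc_app g (take `|q| (drop j s)) :: drop (j + `|q|) s).
Proof. by move=> sr; rewrite {1}/rc_app /happ insubT ?sr. Qed.

Lemma rc_app_neg n (f : relcochain S n) s : n < 0 -> rc_app f s = 0.
Proof. by move=> n0; apply: happ_out; lia. Qed.

Lemma chain_values_comp (p q r : int) (e : p + q = r + 1) (j : 'I_`|p|)
    (f : relcochain S p) (g : relcochain S q) :
  chain_values (hcomp e j f g) = scomp e j (chain_values f) (chain_values g).
Proof.
apply/funext => v; rewrite /scomp !sc_app_chain_values /chain_values.
have [/eqP vN sv] : \val v != [::] /\ (size (\val v))%:Z = r + 1.
  by have /and3P[? /eqP ?] := simplexP v.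
have sorted_v : sorted <=%O (\val v) by have /and3P[] := simplexP v.
case: (\val v) vN sv sorted_v => // i w _ sv iw.
have sw : (size w)%:Z = r by move: sv => /=; lia.
rewrite {1}/mor_value rc_app_hcomp ?size_pairmap //.
have zero n (h : relcochain S n) u : n < 0 -> mor_value (rc_app h) u = 0.
  by move=> n0; case: u => //= ? ?; rewrite rc_app_neg // icoef0.
have [p0|p0] := ltP p 0; first by rewrite rc_app_neg // icoef0 zero // mul0r.
have [q0|q0] := ltP q 0.
  rewrite [rc_app g _]rc_app_neg // relative0; last exact: rc_relative.
  by rewrite icoef0 [X in _ * X]zero // mulr0.
case: p p0 f j e => // p _ f j e; case: q q0 g e => // q _ g e.
have jp := ltn_ord j; rewrite /= in iw.
have swN : size w = (p + q).-1 by lia.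
(* As w omits the initial vertex i, it has one entry per morphism, and [p2] marks the q morphisms
   fed to g. The cuts of the full sequence [i :: w] share the boundary vertices [last i p1] and
   [last i (p1 ++ p2)]. *)
have [p1 [p2 [p3 [ew sp1 sp2]]]] :
    exists p1 p2 p3, [/\ w = p1 ++ p2 ++ p3, size p1 = j & size p2 = q].
  exists (take j w), (take q (drop j w)), (drop q (drop j w)).
  by rewrite !cat_take_drop !size_takel ?size_drop ?swN //; lia.
  subst w; rewrite -[RHS]/(mor_value _ (i :: take j (p1 ++ p2 ++ p3) ++ _) * _).
  have -> : drop (j + q) (i :: p1 ++ p2 ++ p3) = last i (p1 ++ p2) :: p3.
    by rewrite catA -drop_size_last size_cat sp1 sp2.
  have -> : take q.+1 (drop j (i :: p1 ++ p2 ++ p3)) = last i p1 :: p2.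
    by rewrite -sp1 drop_size_last /= take_size_cat.
  rewrite take_size_cat // -(mor_value_insertion (rc_relative f)) //;
    last exact: rc_relative.
  rewrite !pairmap_cat -last_cat take_size_cat ?size_pairmap //.
  rewrite drop_size_cat ?size_pairmap // take_size_cat ?size_pairmap //.
  by rewrite catA drop_size_cat // size_cat !size_pairmap sp1 sp2.
Qed.

Lemma phi_comp (p q r : int) (e : p + q = r + 1) (j : 'I_`|p|)
    (f : scochain k P p) (g : scochain k P q) :
  phi (scomp e j f g) = hcomp e j (phi f) (phi g).
Proof.
by apply: chain_values_inj; rewrite chain_values_comp !phiK.
Qed.

Lemma phi_mult : phi (op_mult (simplicial k P)) = hmult S.
Proof.
apply: chain_values_inj; rewrite phiK; apply/funext => v; rewrite /chain_values.
have /and3P[_ /eqP sv] := simplexP v.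
case: (\val v) sv => [|i [|x [|l [|? ?]]]] //= _ /and3P[ix xl _].
rewrite /rc_app /happ insubT //= /hmult_fun /=.
rewrite [imul _ _](mor_comp k lfP ix xl).
by rewrite icoef_mor ?eqxx // (le_trans ix xl).
Qed.

Lemma phi_is_Phi : is_Phi phi.
Proof.
split=> [f|n f i [|x p] n0 sp ip].
- rewrite (relative_nil (rc_relative _)) -sc_app_chain_values phiK //.
- by rewrite -sp in n0.
- by rewrite (relative_mor (rc_relative _)) -sc_app_chain_values phiK.
Qed.

(** The prescribed values are exactly the [chain_values], which determine a relative cochain; in
    negative degrees there are no simplices to check. *)
Lemma is_Phi_unique (psi : cochain_map k lfP) : is_Phi psi -> psi = phi.
Proof.
move=> [psi0 psiS]; apply/functional_extensionality_dep => n; apply/funext => f.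
apply: chain_values_inj; rewrite phiK; apply/funext => v; rewrite /chain_values.
rewrite -[RHS]sc_app_val; have /and3P[] := simplexP v.
case: (\val v) => //= i p _ sn ip.
case: n f v sn => [[|n]|n] f v sn.
- case: p ip sn => //= _ _; rewrite psi0 icoef_diag_sum //.
- rewrite psiS //; last by lia.
  by rewrite icoefZ icoef_mor ?path_le_last // !eqxx mulr1.
- by lia.
Qed.

End Phi.

Theorem corollary2p5 (k : fieldType) (char0 : [pchar k]%R =i pred0)
    (d : Order.disp_t) (P : porderType d) (lfP : locally_finite P) :
  exists Phi : cochain_map k lfP,
    [/\ is_Phi Phi,
        forall Psi : cochain_map k lfP, is_Phi Psi -> Psi = Phi
      & is_dgLie_iso (shift_map Phi)].
Proof.
exists (@phi k d P lfP); split; [exact: phi_is_Phi|exact: is_Phi_unique|].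
have bij a : bijective (shift_map (@phi k d P lfP) (a := a)).
  exists (@chain_values k d P lfP (a + 1)); [exact: phiK|exact: chain_valuesK].
have lin a : linear (shift_map (@phi k d P lfP) (a := a)) by exact: phi_linear.
have br := @op_morphism_bracket k (simplicial k P) (hochschild (@id_subalgebra k d P lfP))
  (@phi k d P lfP) (@phi_linear k d P lfP) (@phi_comp k d P lfP).
have df := @op_morphism_diff k (simplicial k P) (hochschild (@id_subalgebra k d P lfP))
  (@phi k d P lfP) (@phi_linear k d P lfP) (@phi_comp k d P lfP) (@phi_mult k d P lfP).
have src := simplicial_dgLie P char0.
split=> //; exact: is_dgLie_transfer src lin bij br df.
Qed.
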